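(* Let $n\ge 2$, let $K\subset\mathbb{R}^n$ be a convex body of constant width $\Theta$, and let $\gamma\subset\mathbb{R}^n$ be any curve such that $K\subset\operatorname{co}(\gamma)$. Then $$ \operatorname{length}(\gamma)\ge \frac{2(\pi-1)\,\Gamma\!\left(\frac{n+1}{2}\right)}{\sqrt{\pi}\,\Gamma\!\left(\frac{n}{2}\right)}\cdot\Theta, $$ where $\Gamma$ is the gamma function.
   Context: $\mathbb{R}^n$ carries the standard Euclidean metric $d$. A convex body is any nonempty compact convex subset of $\mathbb{R}^n$. $\operatorname{co}(A)$ denotes the convex hull of $A$. The support function of $K$ is $h(K,u)=\sup\{(x,u):x\in K\}$ and the width function is $w(K,u)=h(K,u)+h(K,-u)$ for $u$ in the unit sphere $S^{n-1}$; $K$ has constant width $\Theta$ if $w(K,u)=\Theta$ for all $u\in S^{n-1}$. A curve is the image of a continuous map $\varphi:[a,b]\to\mathbb{R}^n$; its length is $\operatorname{length}(\gamma)=\sup\sum_{i=1}^m d(\varphi(t_{i-1}),\varphi(t_i))$ over all partitions $a=t_0<\dots<t_m=b$ (possibly $+\infty$). *)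

(* Defs.v *)
From HB Require Import structures.
From mathcomp Require Import all_boot all_order all_algebra.
From mathcomp Require Import all_classical all_reals all_analysis.
Set Implicit Arguments. Unset Strict Implicit. Unset Printing Implicit Defensive.
Import Order.TTheory GRing.Theory Num.Theory.
Import numFieldNormedType.Exports.
Local Open Scope classical_set_scope.
Local Open Scope ring_scope.

Section Defs.
Variable R : realType.

Definition dotp n (x y : 'rV[R]_n) : R := \sum_(i < n) x ord0 i * y ord0 i.

Definition edist n (x y : 'rV[R]_n) : R := Num.sqrt (dotp (x - y) (x - y)).

Definition convex_set n (K : set 'rV[R]_n) : Prop :=
  forall x y t, K x -> K y -> 0 <= t <= 1 -> K (t *: x + (1 - t) *: y).

Definition convex_body n (K : set 'rV[R]_n) : Prop :=
  K !=set0 /\ compact K /\ convex_set K.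

Definition co n (A : set 'rV[R]_n) : set 'rV[R]_n :=
  [set x | exists (m : nat) (p : 'I_m -> 'rV[R]_n) (l : 'I_m -> R),
     (forall i, A (p i)) /\ (forall i, 0 <= l i) /\
     \sum_(i < m) l i = 1 /\ x = \sum_(i < m) l i *: p i].

Definition support_fun n (K : set 'rV[R]_n) (u : 'rV[R]_n) : R :=
  sup [set dotp x u | x in K].

Definition width_fun n (K : set 'rV[R]_n) (u : 'rV[R]_n) : R :=
  support_fun K u + support_fun K (- u).

Definition constant_width n (K : set 'rV[R]_n) (Theta : R) : Prop :=
  forall u : 'rV[R]_n, dotp u u = 1 -> width_fun K u = Theta.

Definition partition (a b : R) (m : nat) (t : nat -> R) : Prop :=
  t 0%N = a /\ t m = b /\ (forall i, (i < m)%N -> t i < t i.+1).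

Definition curve_length n (phi : R -> 'rV[R]_n) (a b : R) : \bar R :=
  ereal_sup [set l : \bar R | exists (m : nat) (t : nat -> R),
     partition a b m t /\
     l = (\sum_(i < m) edist (phi (t i)) (phi (t i.+1)))%:E].

Definition Gamma (x : R) : R :=
  Rintegral lebesgue_measure `]0, +oo[%classic
    (fun t : R => t `^ (x - 1) * expR (- t)).

End Defs.

(* Main.v *)
Require Import Defs.
From HB Require Import structures.
From mathcomp Require Import all_boot all_order all_algebra.
From mathcomp Require Import all_classical all_reals all_analysis.
From mathcomp Require Import measurable_realfun ring lra.
Set Implicit Arguments. Unset Strict Implicit. Unset Printing Implicit Defensive.
Import Order.TTheory GRing.Theory Num.Theory.
Import numFieldNormedType.Exports.
Local Open Scope classical_set_scope.
Local Open Scope ring_scope.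

(** Inscribe in the curve a polygon [P 0, ..., P m] coming within [e] of each of
    its points.  In a unit direction [u] it must sweep an interval of length at
    least [T = Theta - 2 e], so the total variation of [(P i, u)] is at least
    [2 T - |(P 0 - P m, u)|].  Averaging over a Gaussian vector [g] in place of
    [u] turns total variation into length (since [E |(v, g)| = |v| / sqrt pi])
    and gives [length >= 2 sqrt pi rho_n T - d], where [d = |P 0 - P m|] and
    [rho_n = E |g| = Gamma ((n + 1) / 2) / Gamma (n / 2)].

    If [d <= 2 rho_n T / sqrt pi], this is the claim.  Otherwise project along
    [P 0 - P m]: the projected polygon is closed, so the same estimate in
    dimension [n - 1] bounds its length below by [2 sqrt pi rho_(n-1) T], while
    the component along [P 0 - P m] has variation at least [d].  Hence
    [length ^ 2 >= d ^ 2 + 4 pi rho_(n-1) ^ 2 T ^ 2], and this is large enough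
    because [rho_(n-1) ^ 2 >= (1 - 2 / pi) rho_n ^ 2], which follows from
    [rho_(n-1) rho_n = (n - 1) / 2] and [pi < 16 / 5]. *)

(** * An upper bound for pi *)

Section PiBound.
Variable R : realType.
Implicit Types f df : R -> R.

Lemma ge0_derive_le0 f df : (forall x, is_derive x (1 : R) f (df x)) ->
  (forall x, 0 <= x -> 0 <= df x) -> forall x, 0 <= x -> f 0 <= f x.
Proof.
move=> f_df df0 x x0; apply: (@ger0_derive1_le_cc _ f 0 x) => //.
- move=> y; rewrite in_itv/= => /andP[y0 _].
  by rewrite derive1E; case: (f_df y) => _ ->; rewrite df0// ltW.
- apply: continuous_subspaceT => y.
  by apply/differentiable_continuous/derivable1_diffP; case: (f_df y).
- by rewrite in_itv/= lexx x0.
- by rewrite in_itv/= x0 lexx.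
Qed.

Lemma sin_le_id x : 0 <= x -> sin x <= x :> R.
Proof.
move=> x0; rewrite -subr_ge0.
have -> : 0 = 0 - sin 0 :> R by rewrite sin0 subr0.
apply: (@ge0_derive_le0 (fun x => x - sin x) (fun x => 1 - cos x)) x0 => y _.
by rewrite subr_ge0 cos_le1.
Qed.

Lemma cos_ge_quadratic x : 0 <= x -> 1 - x ^+ 2 / 2 <= cos x :> R.
Proof.
move=> x0; rewrite -subr_ge0.
have -> : 0 = cos 0 - (1 - 0 ^+ 2 / 2) :> R
  by rewrite cos0 expr0n mul0r subr0 subrr.
apply: (@ge0_derive_le0 (fun x => cos x - (1 - x ^+ 2 / 2))
  (fun x => x - sin x)) => //.
  by move=> y; apply: is_derive_eq; rewrite /GRing.scale /=; field.
by move=> y y0; rewrite subr_ge0 sin_le_id.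
Qed.

Lemma sin_ge_cubic x : 0 <= x -> x - x ^+ 3 / 6 <= sin x :> R.
Proof.
move=> x0; rewrite -subr_ge0.
have -> : 0 = sin 0 - (0 - 0 ^+ 3 / 6) :> R by rewrite sin0 expr0n mul0r !subr0.
apply: (@ge0_derive_le0 (fun x => sin x - (x - x ^+ 3 / 6))
  (fun x => cos x - (1 - x ^+ 2 / 2))) => // [y|y y0].
  by apply: is_derive_eq; rewrite /GRing.scale /=; field.
by rewrite subr_ge0 cos_ge_quadratic.
Qed.

(* [sin (pi / 4) ^ 2] is [1 / 2], but [(4 / 5 - (4 / 5) ^ 3 / 6) ^ 2 > 1 / 2]. *)
Lemma pi_lt_16_5 : pi < 16 / 5 :> R.
Proof.
rewrite ltNge; apply/negP => pi_ge.
pose y : R := pi / 4.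
have y_le : y <= 1 by have := pihalf_lt2 R; rewrite /y; lra.
have y_ge : 4 / 5 <= y by rewrite /y; lra.
have y0 : 0 <= y by lra.
have siny2 : sin y ^+ 2 = 1 / 2.
  have yE : y *+ 2 = pi / 2 by rewrite /y; field.
  have := cos_mulr2n y; rewrite yE cos_pihalf cos2sin2; lra.
have sin_ge : 71 / 100 <= sin y.
  apply: le_trans (sin_ge_cubic y0).
  have y2 : y ^+ 2 <= 1 by rewrite expr_le1.
  have : 0 <= (y - 4 / 5) * (1 - (y ^+ 2 + 4 / 5 * y + 16 / 25) / 6).
    by apply: mulr_ge0; lra.
  lra.
by nra.
Qed.

End PiBound.

(** * Lipschitz functions *)

Section LipschitzTheory.
Variable R : realType.
Implicit Types U V W : normedModType R.

Lemma lipschitzP V W (f : V -> W) :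
  lipschitz f <-> exists2 L, 0 <= L & forall x y, `|f x - f y| <= L * `|x - y|.
Proof.
split=> [/pinfty_ex_gt0[L L_gt0 fL]|[L _ fL]].
  by exists L => [|x y]; [exact: ltW|exact: (fL (x, y))].
apply: (@klipschitzW _ _ _ L); last by move=> [x y] _; exact: fL.
exact: (@globally_properfilter _ _ (0, 0)).
Qed.

Lemma lipschitz_continuous V W (f : V -> W) : lipschitz f -> continuous f.
Proof.
move=> /lipschitzP[L L_ge0 fL] x; apply/cvgrPdist_le => /= e e_gt0.
near=> y; apply: (le_trans (fL x y)).
apply: (@le_trans _ _ ((L + 1) * `|x - y|)); first by rewrite ler_wpM2r// lerDl.
rewrite mulrC -ler_pdivlMr ?ltr_wpDl//.
near: y; apply: cvgr_dist_le; [exact: cvg_id|by rewrite divr_gt0// ltr_wpDl].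
Unshelve. all: by end_near. Qed.

Lemma lipschitz_cst V W (w : W) : lipschitz (fun _ : V => w).
Proof. by apply/lipschitzP; exists 0 => // x y; rewrite subrr normr0 mul0r. Qed.

Lemma lipschitz_normr V : lipschitz (fun x : V => `|x|).
Proof.
by apply/lipschitzP; exists 1 => // x y; rewrite mul1r ler_dist_dist.
Qed.

Lemma lipschitzD V W (f g : V -> W) :
  lipschitz f -> lipschitz g -> lipschitz (fun x => f x + g x).
Proof.
move=> /lipschitzP[L L_ge0 fL] /lipschitzP[M M_ge0 gM]; apply/lipschitzP.
exists (L + M) => [|x y]; first exact: addr_ge0.
by rewrite opprD addrACA mulrDl (le_trans (ler_normD _ _))// lerD.
Qed.

Lemma lipschitzZ V W (c : R) (f : V -> W) :
  lipschitz f -> lipschitz (fun x => c *: f x).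
Proof.
move=> /lipschitzP[L L_ge0 fL]; apply/lipschitzP.
exists (`|c| * L) => [|x y]; first exact: mulr_ge0.
by rewrite -scalerBr normrZ -mulrA ler_wpM2l.
Qed.

Lemma lipschitz_sum V W I (r : seq I) (f : I -> V -> W) :
  (forall i, lipschitz (f i)) -> lipschitz (fun x => \sum_(i <- r) f i x).
Proof.
move=> lf; elim: r => [|i r IH].
  by under eq_fun do rewrite big_nil; exact: lipschitz_cst.
by under eq_fun do rewrite big_cons; exact: lipschitzD.
Qed.

Lemma lipschitz_comp U V W (g : U -> V) (f : V -> W) :
  lipschitz f -> lipschitz g -> lipschitz (fun x => f (g x)).
Proof.
move=> /lipschitzP[L L_ge0 fL] /lipschitzP[M M_ge0 gM]; apply/lipschitzP.
exists (L * M) => [|x y]; first exact: mulr_ge0.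
by rewrite (le_trans (fL _ _))// -mulrA ler_wpM2l.
Qed.

Lemma lipschitz_affine (c d : R) : lipschitz (fun x : R => c * x + d).
Proof.
apply/lipschitzP; exists `|c| => // x y.
by rewrite opprD addrACA subrr addr0 -mulrBr normrM.
Qed.

End LipschitzTheory.
Arguments lipschitz_cst {R V W}.
Arguments lipschitz_normr {R V}.

(** * Gaussian means on the line *)

Section GaussMean.
Variable R : realType.
Implicit Types F f h : R -> R.
Notation mu := (@lebesgue_measure R).
Notation g := (@gauss_fun R).

Lemma ge0_integralN F : measurable_fun setT F -> (forall x, 0 <= F x) ->
  (\int[mu]_x (F (- x))%:E = \int[mu]_x (F x)%:E)%E.
Proof.
move=> mF F0.
transitivity (\int[pushforward mu (-%R : _ -> measurableTypeR R)]_x (F x)%:E)%E.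
  rewrite ge0_integral_pushforward//=; first exact/measurable_EFinP.
  by move=> x _; rewrite lee_fin.
by apply: eq_measure_integral => //= A mA _; exact: lebesgue_measureN.
Qed.

Lemma ge0_integral_affine_gt0 F (c d : R) : 0 < c ->
  continuous F -> (forall x, 0 <= F x) ->
  (\int[mu]_x (F x)%:E = \int[mu]_x (F (c * x + d) * c)%:E)%E.
Proof.
move=> c0 cF F0; pose T (x : R^o) : R^o := (x + d / c) * c.
have TE x : T x = c * x + d by rewrite /T mulrDl divfK ?gt_eqF// mulrC.
have T'E : T^`()%classic = cst c.
  apply/funext => x; rewrite /T derive1E deriveM// deriveD// derive_cst scaler0.
  by rewrite add0r derive_id derive_cst addr0 [LHS]mulr1.
rewrite (@increasing_ge0_integration_by_substitutionT _ T F)//.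
- by rewrite T'E; apply: eq_integral => x _; rewrite !fctE/= -TE.
- by move=> x y xy; rewrite !TE ltrD2r ltr_pM2l.
- by rewrite T'E => ?; exact: cvg_cst.
- by rewrite T'E; exact: is_cvg_cst.
- by rewrite T'E; exact: is_cvg_cst.
- by apply/gt0_cvgMlNy => //; exact: cvg_addrr_Ny.
- by apply/gt0_cvgMly => //; exact: cvg_addrr.
Qed.

Lemma continuous_comp_affine F (c d : R) : continuous F ->
  continuous (fun x => F (c * x + d)).
Proof.
move=> cF x; apply: continuous_comp; last exact: cF.
exact: (lipschitz_continuous (lipschitz_affine c d)).
Qed.

Lemma ge0_integral_affine F (c d : R) : c != 0 ->
  continuous F -> (forall x, 0 <= F x) ->
  (\int[mu]_x (F x)%:E = \int[mu]_x (F (c * x + d) * `|c|)%:E)%E.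
Proof.
move=> /lt_total/orP[c_lt0|c_gt0] cF F0; last first.
  by rewrite gtr0_norm//; exact: ge0_integral_affine_gt0.
rewrite ltr0_norm// (@ge0_integral_affine_gt0 F (- c) d) ?oppr_gt0//.
rewrite -ge0_integralN.
- by apply: eq_integral => x _; rewrite mulrNN.
- apply: continuous_measurable_fun => x.
  by apply: cvgM; [exact: continuous_comp_affine|exact: cvg_cst].
- by move=> x; rewrite mulr_ge0// oppr_ge0 ltW.
Qed.

Lemma is_derive_gauss_fun (x : R) : is_derive x 1 g (- (2 * x * g x)).
Proof.
have dN : is_derive x 1 (fun x : R => - x ^+ 2) (- (2 * x)).
  by apply: is_derive_eq; rewrite /GRing.scale /=; ring.
have := is_derive1_comp (is_derive_expR _) dN.
by rewrite /gauss_fun => h; apply: is_derive_eq; rewrite mulrN mulrC.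
Qed.

Lemma is_derive_gauss_primitive (x : R) :
  is_derive x 1 (fun x => - g x / 2) (x * g x).
Proof.
have dg := is_derive_gauss_fun x.
by apply: is_derive_eq; rewrite /GRing.scale /=; field.
Qed.

Lemma continuous_normX k : continuous (fun r : R => `|r| ^+ k).
Proof.
move=> r; apply: (@continuous_comp _ _ _ (fun r : R => `|r|) (fun r => r ^+ k)).
  exact: norm_continuous.
exact: exprn_continuous.
Qed.

Lemma continuous_normX_gauss k : continuous (fun r : R => `|r| ^+ k * g r).
Proof.
by move=> r; apply: cvgM; [exact: continuous_normX|exact: continuous_gauss_fun].
Qed.

Lemma normX_gauss_ge0 k x : 0 <= `|x| ^+ k * g x.
Proof. by rewrite mulr_ge0 ?exprn_ge0 ?gauss_fun_ge0. Qed.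

Definition gauss_moment k : \bar R := (\int[mu]_x (`|x| ^+ k * g x)%:E)%E.

Lemma gauss_moment_halfline k :
  (gauss_moment k = 2%:E * \int[mu]_(x in `[0%R, +oo[) (`|x| ^+ k * g x)%:E)%E.
Proof.
rewrite /gauss_moment ge0_symfun_integralT -?set_itvcy//.
- exact: normX_gauss_ge0.
- exact: continuous_normX_gauss.
- by move=> x /=; rewrite normrN /gauss_fun sqrrN.
Qed.

Lemma gauss_moment0 : gauss_moment 0 = (Num.sqrt pi)%:E.
Proof.
by rewrite -integralT_gauss; apply: eq_integral => x _; rewrite expr0 mul1r.
Qed.

Lemma gauss_moment1 : gauss_moment 1 = 1%E.
Proof.
rewrite gauss_moment_halfline.
transitivity (2%:E * \int[mu]_(x in `[0%R, +oo[) (x * g x)%:E)%E.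
  congr (_ * _)%E; apply: eq_integral => x; rewrite inE/= in_itv/= andbT => x0.
  by rewrite ger0_norm.
rewrite (@ge0_continuous_FTC2y _ (fun x => x * g x) (fun x => - g x / 2) 0 0).
- by rewrite /gauss_fun expr0n oppr0 expR0 sub0e -EFinN -EFinM; congr EFin; lra.
- by move=> x x0; rewrite mulr_ge0// gauss_fun_ge0.
- apply: continuous_subspaceT => x.
  by apply: cvgM; [exact: cvg_id|exact: continuous_gauss_fun].
- have -> : 0 = - 0 / 2 :> R by rewrite oppr0 mul0r.
  by apply: cvgMr_tmp; apply: cvgN; exact: cvg_gauss_fun.
- by move=> x _; case: (is_derive_gauss_primitive x).
- apply: cvg_at_right_filter; apply: cvgMr_tmp; apply: cvgN.
  exact: continuous_gauss_fun.
- by move=> x _; rewrite derive1E; case: (is_derive_gauss_primitive x).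
Qed.

Lemma measurable_funM_gauss f : continuous f ->
  measurable_fun setT (fun x => (f x * g x)%:E).
Proof.
move=> cf; apply/measurable_EFinP/measurable_funM;
  last exact: measurable_gauss_fun.
exact: continuous_measurable_fun.
Qed.

Lemma integrable_lipschitzM_gauss f : lipschitz f ->
  mu.-integrable setT (EFin \o (fun x => f x * g x)).
Proof.
move=> /[dup] /lipschitz_continuous cf /lipschitzP[L L_ge0 fL].
have int_normr : mu.-integrable setT (EFin \o (fun x : R => `|x| * g x)).
  apply/integrableP; split.
    by apply: measurable_funM_gauss; exact: norm_continuous.
  under eq_integral do rewrite /= ger0_norm ?mulr_ge0 ?gauss_fun_ge0//.
  by rewrite -/(gauss_moment 1) gauss_moment1 ltry.
have : mu.-integrable setT (fun x : R => `|f 0|%:E * (g x)%:E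
    + L%:E * (`|x| * g x)%:E)%E.
  by apply: integrableD => //; apply: integrableZl => //;
    exact: integrableT_gauss.
apply: le_integrable => //; first exact: measurable_funM_gauss.
move=> x _ /=; rewrite lee_fin normrM (ger0_norm (gauss_fun_ge0 x)).
rewrite [leRHS]ger0_norm; last by rewrite addr_ge0// !mulr_ge0// gauss_fun_ge0.
rewrite mulrA -mulrDl ler_wpM2r ?gauss_fun_ge0//.
rewrite -lerBlDl; apply: (le_trans (lerB_dist _ _)).
by have := fL x 0; rewrite subr0.
Qed.

Lemma sqrt_pi_gt0 : 0 < Num.sqrt pi :> R.
Proof. by rewrite sqrtr_gt0 pi_gt0. Qed.

(* The density [exp (- x ^ 2) / sqrt pi] has variance [1 / 2]: no factor
   [sqrt 2] appears in the Gamma quotients below. *)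
Definition gauss_mean f : R := (Num.sqrt pi)^-1 * (\int[mu]_x (f x * g x)).

Lemma gauss_meanE f : lipschitz f ->
  ((gauss_mean f)%:E = (Num.sqrt pi)^-1%:E * \int[mu]_x (f x * g x)%:E)%E.
Proof.
move=> lf; rewrite /gauss_mean EFinM fineK//.
by apply: integrable_fin_num => //; exact: integrable_lipschitzM_gauss.
Qed.

Lemma eq_gauss_mean f h : f =1 h -> gauss_mean f = gauss_mean h.
Proof. by move=> /funext->. Qed.

Lemma gauss_mean_cst c : gauss_mean (fun=> c) = c.
Proof.
rewrite /gauss_mean RintegralZl//; last exact: integrableT_gauss.
by rewrite /Rintegral integralT_gauss /= mulrCA mulVf ?mulr1// gt_eqF
  ?sqrt_pi_gt0.
Qed.

Lemma gauss_meanD f h : lipschitz f -> lipschitz h ->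
  gauss_mean (fun x => f x + h x) = gauss_mean f + gauss_mean h.
Proof.
move=> lf lh; rewrite /gauss_mean -mulrDr -RintegralD//;
  try exact: integrable_lipschitzM_gauss.
by congr (_ * _); apply: eq_Rintegral => x _; rewrite mulrDl.
Qed.

Lemma gauss_meanZ c f : lipschitz f ->
  gauss_mean (fun x => c * f x) = c * gauss_mean f.
Proof.
move=> lf; rewrite /gauss_mean [RHS]mulrCA; congr (_ * _).
rewrite -RintegralZl//; first by apply: eq_Rintegral => x _; rewrite mulrA.
exact: integrable_lipschitzM_gauss.
Qed.

Lemma gauss_mean_le f h : lipschitz f -> lipschitz h ->
  (forall x, f x <= h x) -> gauss_mean f <= gauss_mean h.
Proof.
move=> lf lh fh; rewrite /gauss_mean ler_wpM2l ?invr_ge0 ?sqrtr_ge0//.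
apply: le_Rintegral => //; try exact: integrable_lipschitzM_gauss.
by move=> x _; rewrite ler_wpM2r ?gauss_fun_ge0.
Qed.

Lemma gauss_mean_ge0 f :
  lipschitz f -> (forall x, 0 <= f x) -> 0 <= gauss_mean f.
Proof.
by move=> lf f0; rewrite -(gauss_mean_cst 0) gauss_mean_le//;
  exact: lipschitz_cst.
Qed.

Lemma gauss_mean_dist f h e : lipschitz f -> lipschitz h ->
  (forall x, `|f x - h x| <= e) -> `|gauss_mean f - gauss_mean h| <= e.
Proof.
have mean_sub f1 f2 : lipschitz f1 -> lipschitz f2 ->
    (forall x, `|f1 x - f2 x| <= e) -> gauss_mean f1 - gauss_mean f2 <= e.
  move=> l1 l2 f12; rewrite lerBlDl -[X in _ + X](gauss_mean_cst e).
  rewrite -gauss_meanD//; last exact: lipschitz_cst.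
  apply: gauss_mean_le => //.
    by apply: lipschitzD => //; exact: lipschitz_cst.
  by move=> x; rewrite -lerBlDl (le_trans (ler_norm _)).
move=> lf lh fh; rewrite ler_norml; apply/andP; split; last exact: mean_sub.
by rewrite lerNl opprB; apply: mean_sub => // x; rewrite distrC.
Qed.

Lemma gauss_mean_normr : gauss_mean (fun x => `|x|) = (Num.sqrt pi)^-1.
Proof.
by rewrite /gauss_mean /Rintegral -/(gauss_moment 1) gauss_moment1 mulr1.
Qed.

Lemma lipschitz_gauss_mean (f : R -> R -> R) L : 0 <= L ->
  (forall s, lipschitz (f s)) ->
  (forall s s' t, `|f s t - f s' t| <= L * `|s - s'|) ->
  lipschitz (fun s => gauss_mean (f s)).
Proof.
by move=> L0 lf fL; apply/lipschitzP; exists L => // s s';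
  apply: gauss_mean_dist.
Qed.

End GaussMean.

Section GaussRotation.
Variable R : realType.
Implicit Types F : R -> R.
Notation mu := (@lebesgue_measure R).
Notation g := (@gauss_fun R).

Lemma lebesgue_fubini_tonelli (H : R * R -> \bar R) : measurable_fun setT H ->
  (forall p, (0 <= H p)%E) ->
  (\int[mu]_x \int[mu]_y H (x, y) = \int[mu]_y \int[mu]_x H (x, y))%E.
Proof.
exact: (@fubini_tonelli _ _ _ _ R (mu : {sigma_finite_measure set _ -> \bar R})
  (mu : {sigma_finite_measure set _ -> \bar R})).
Qed.

Lemma measurable_integral_snd (H : R * R -> \bar R) : measurable_fun setT H ->
  (forall p, (0 <= H p)%E) ->
  measurable_fun setT (fun x => \int[mu]_y H (x, y))%E.
Proof.
exact: (@measurable_fun_fubini_tonelli_F _ _ _ _ R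
  (mu : {sigma_finite_measure set _ -> \bar R})).
Qed.

Lemma gauss_fun_rotation a b s z : b != 0 -> a ^+ 2 + b ^+ 2 = 1 ->
  g (b^-1 * z - a * s / b) * g s = g z * g (b^-1 * s - a / b * z).
Proof.
move=> b0 ab; have a2 : a ^+ 2 = 1 - b ^+ 2 by rewrite -ab [RHS]addrK.
by rewrite /gauss_fun -!expRD; congr expR; field: a2.
Qed.

(* Substitute [z = b * t + a * s] for [t], exchange the integrals and substitute
   [(s - a * z) / b] for [s]. *)
Lemma integral_gauss_rotation F a b : b != 0 -> a ^+ 2 + b ^+ 2 = 1 ->
  continuous F -> (forall x, 0 <= F x) ->
  (\int[mu]_s \int[mu]_t (F (b * t + a * s) * g t * g s)%:E =
   (Num.sqrt pi)%:E * \int[mu]_z (F z * g z)%:E)%E.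
Proof.
move=> b0 ab cF F0; have cg := @continuous_gauss_fun R.
have bV0 : b^-1 != 0 by rewrite invr_eq0.
pose slanted (p : R * R) :=
  (F p.2 * g p.2 * (g (b^-1 * p.1 + - (a / b) * p.2) * `|b^-1|))%:E.
have slanted_ge0 p : (0 <= slanted p)%E
  by rewrite lee_fin !mulr_ge0 ?gauss_fun_ge0.
have mg := @measurable_gauss_fun R.
have mF : measurable_fun setT F by exact: continuous_measurable_fun.
have measurable_slanted : measurable_fun setT slanted.
  apply/measurable_EFinP; apply: measurable_funM.
    by apply: measurable_funM; apply: measurableT_comp.
  apply: measurable_funM => //; apply: measurableT_comp => //.
  by apply: measurable_funD; apply: measurable_funM.
transitivity (\int[mu]_s \int[mu]_z slanted (s, z))%E.
  apply: eq_integral => s _.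
  rewrite (@ge0_integral_affine _ (fun t => F (b * t + a * s) * g t * g s)
    b^-1 (- (a * s / b)))//.
  - apply: eq_integral => z _; rewrite /slanted /= mulNr; congr EFin.
    have -> : b * (b^-1 * z - a * s / b) + a * s = z by field.
    by rewrite !mulrA -(mulrA (F z)) gauss_fun_rotation// !mulrA.
  - move=> t; apply: cvgM; last exact: cvg_cst.
    by apply: cvgM; [exact: continuous_comp_affine|exact: cg].
  - by move=> t; rewrite !mulr_ge0 ?gauss_fun_ge0.
rewrite lebesgue_fubini_tonelli// -ge0_integralZl//; last 2 first.
- exact: measurable_funM_gauss.
- by move=> z _; rewrite lee_fin mulr_ge0 ?gauss_fun_ge0.
apply: eq_integral => z _; rewrite /slanted /= muleC.
under eq_integral do rewrite EFinM.
rewrite ge0_integralZl//; last 3 first.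
- apply/measurable_EFinP/measurable_funM => //.
  by apply: continuous_measurable_fun; exact: continuous_comp_affine.
- by move=> s _; rewrite lee_fin mulr_ge0 ?gauss_fun_ge0.
- by rewrite lee_fin mulr_ge0 ?gauss_fun_ge0.
rewrite -ge0_integral_affine ?integralT_gauss//.
by move=> x; exact: gauss_fun_ge0.
Qed.

Lemma gauss_meanM_unit F a : `|a| = 1 -> lipschitz F -> (forall x, 0 <= F x) ->
  gauss_mean (fun x => F (a * x)) = gauss_mean F.
Proof.
move=> a1 lF F0; have a0 : a != 0 by rewrite -normr_eq0 a1 oner_eq0.
rewrite /gauss_mean /Rintegral; congr (_ * fine _).
rewrite [RHS](@ge0_integral_affine _ (fun x => F x * g x) a 0)//.
- apply: eq_integral => x _; rewrite addr0 a1 mulr1 /gauss_fun exprMn.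
  by rewrite -(real_normK (num_real a)) a1 expr1n mul1r.
- move=> x; apply: cvgM; last exact: continuous_gauss_fun.
  exact: lipschitz_continuous.
- by move=> x; rewrite mulr_ge0 ?gauss_fun_ge0.
Qed.

Lemma gauss_mean_rotation F a b : a ^+ 2 + b ^+ 2 = 1 ->
  lipschitz F -> (forall x, 0 <= F x) ->
  gauss_mean (fun s => gauss_mean (fun t => F (b * t + a * s))) = gauss_mean F.
Proof.
move=> ab lF F0; have cF := lipschitz_continuous lF.
have lFs s : lipschitz (fun t => F (b * t + a * s)).
  exact: lipschitz_comp lF (lipschitz_affine _ _).
have [b_eq0|b_neq0] := eqVneq b 0.
  have a1 : `|a| = 1.
    apply/eqP; rewrite -sqrp_eq1// real_normK ?num_real//.
    by rewrite -ab b_eq0 expr0n addr0.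
  rewrite b_eq0 -[RHS](gauss_meanM_unit a1 lF F0); apply: eq_gauss_mean => s.
  by under eq_gauss_mean do rewrite mul0r add0r; exact: gauss_mean_cst.
have lmean : lipschitz (fun s => gauss_mean (fun t => F (b * t + a * s))).
  have /lipschitzP[L L0 FL] := lF.
  apply: (@lipschitz_gauss_mean _ _ (L * `|a|)) => // [|s s' t];
    first exact: mulr_ge0.
  apply: (le_trans (FL _ _)).
  by rewrite opprD addrACA subrr add0r -mulrBr normrM mulrA.
apply/EFin_inj; rewrite !gauss_meanE//; congr (_ * _)%E.
have sp0 : Num.sqrt pi != 0 :> R by rewrite gt_eqF ?sqrt_pi_gt0.
have sqrt_piK (X : \bar R) :
    X = ((Num.sqrt pi)^-1%:E * ((Num.sqrt pi)%:E * X))%E.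
  by rewrite muleA -EFinM mulVf// mul1e.
rewrite [RHS]sqrt_piK -(integral_gauss_rotation b_neq0 ab cF F0) [LHS]sqrt_piK.
congr (_ * _)%E; rewrite -ge0_integralZl//; last 2 first.
- exact: measurable_funM_gauss (lipschitz_continuous lmean).
- by move=> s _; rewrite lee_fin mulr_ge0 ?gauss_fun_ge0// gauss_mean_ge0.
apply: eq_integral => s _;
  rewrite EFinM gauss_meanE// !muleA -EFinM mulfV// mul1e.
rewrite -ge0_integralZr//.
- exact: measurable_funM_gauss (lipschitz_continuous (lFs s)).
- by move=> t _; rewrite lee_fin mulr_ge0 ?gauss_fun_ge0.
- by rewrite lee_fin gauss_fun_ge0.
Qed.

Lemma gauss_mean_stable F a b : lipschitz F -> (forall x, 0 <= F x) ->
  gauss_mean (fun s => gauss_mean (fun t => F (b * t + a * s))) =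
  gauss_mean (fun z => F (Num.sqrt (a ^+ 2 + b ^+ 2) * z)).
Proof.
move=> lF F0; set r := Num.sqrt _.
have r2 : r ^+ 2 = a ^+ 2 + b ^+ 2 by rewrite sqr_sqrtr// addr_ge0 ?sqr_ge0.
have [r_eq0|r_neq0] := eqVneq r 0.
  have /eqP : a ^+ 2 + b ^+ 2 = 0 by rewrite -r2 r_eq0 expr0n.
  rewrite paddr_eq0 ?sqr_ge0// !expf_eq0 /= => /andP[/eqP-> /eqP->].
  rewrite r_eq0.
  under eq_gauss_mean => s do under eq_gauss_mean do rewrite !mul0r addr0.
  by under [RHS]eq_gauss_mean do rewrite mul0r; rewrite !gauss_mean_cst.
have unit_ab : (a / r) ^+ 2 + (b / r) ^+ 2 = 1.
  by rewrite !exprMn -mulrDl -r2 -exprMn mulfV// expr1n.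
have lFr : lipschitz (fun z => F (r * z)).
  apply: lipschitz_comp lF _.
  by under eq_fun do rewrite -[_ * _]addr0; exact: lipschitz_affine.
rewrite -[RHS](gauss_mean_rotation unit_ab lFr (fun=> F0 _)).
apply: eq_gauss_mean => s; apply: eq_gauss_mean => t; congr F.
by field.
Qed.

End GaussRotation.

(** * Euclidean row vectors *)

Section EuclideanNorm.
Variable R : realType.

Lemma ler_row_norm n (x : 'rV[R]_n) i : `|x ord0 i| <= `|x|.
Proof. by rewrite [leRHS]mx_normrE (le_bigmax _ _ (ord0, i)). Qed.

Lemma row_norm_le n (x : 'rV[R]_n) e : 0 <= e -> (forall i, `|x ord0 i| <= e) ->
  `|x| <= e.
Proof.
move=> e0 xe; rewrite [leLHS]mx_normrE; apply/bigmax_leP;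
  split=> // -[i j] _ /=.
by rewrite (ord1 i).
Qed.

Section Dotp.
Variable n : nat.
Implicit Types x y z : 'rV[R]_n.

Lemma dotpC x y : dotp x y = dotp y x.
Proof. by apply: eq_bigr => i _; rewrite mulrC. Qed.

Lemma dotpDl x y z : dotp (x + y) z = dotp x z + dotp y z.
Proof. by rewrite -big_split; apply: eq_bigr => i _; rewrite mxE mulrDl. Qed.

Lemma dotpZl c x z : dotp (c *: x) z = c * dotp x z.
Proof.
by rewrite /dotp mulr_sumr; apply: eq_bigr => i _; rewrite mxE mulrA.
Qed.

Lemma dot0p x : dotp 0 x = 0.
Proof. by rewrite -(scale0r 0) dotpZl mul0r. Qed.

Lemma dotpNl x z : dotp (- x) z = - dotp x z.
Proof. by rewrite -scaleN1r dotpZl mulN1r. Qed.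

Lemma dotpBl x y z : dotp (x - y) z = dotp x z - dotp y z.
Proof. by rewrite dotpDl dotpNl. Qed.

Lemma dotpZr c x z : dotp z (c *: x) = c * dotp z x.
Proof. by rewrite !(dotpC z) dotpZl. Qed.

Lemma dotpNr x z : dotp z (- x) = - dotp z x.
Proof. by rewrite !(dotpC z) dotpNl. Qed.

Lemma dotpBr x y z : dotp z (x - y) = dotp z x - dotp z y.
Proof. by rewrite !(dotpC z) dotpBl. Qed.

Lemma dotp_suml I (r : seq I) (F : I -> 'rV[R]_n) z :
  dotp (\sum_(i <- r) F i) z = \sum_(i <- r) dotp (F i) z.
Proof.
elim/big_rec2: _ => [|i y x _ <-]; first exact: dot0p.
by rewrite dotpDl.
Qed.

Lemma dotp_ge0 x : 0 <= dotp x x.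
Proof. by apply: sumr_ge0 => i _; rewrite -expr2 sqr_ge0. Qed.

Definition enorm x : R := Num.sqrt (dotp x x).

Lemma enorm_ge0 x : 0 <= enorm x.
Proof. exact: sqrtr_ge0. Qed.

Lemma sqr_enorm x : enorm x ^+ 2 = dotp x x.
Proof. by rewrite sqr_sqrtr// dotp_ge0. Qed.

Lemma enorm_eq0 x : (enorm x == 0) = (x == 0).
Proof.
apply/eqP/eqP => [x0|->]; last by rewrite /enorm dot0p sqrtr0.
have := sqr_enorm x; rewrite x0 expr0n => /esym/eqP.
rewrite psumr_eq0 => [/allP h|i _]; last by rewrite -expr2 sqr_ge0.
apply/rowP => i; rewrite mxE; apply/eqP.
by have := h i (mem_index_enum _); rewrite mulf_eq0 orbb.
Qed.

Lemma enorm_gt0 x : (0 < enorm x) = (x != 0).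
Proof. by rewrite lt_neqAle enorm_ge0 andbT eq_sym enorm_eq0. Qed.

Lemma enormZ c x : enorm (c *: x) = `|c| * enorm x.
Proof.
by rewrite /enorm dotpZl dotpZr mulrA -expr2 sqrtrM ?sqr_ge0// sqrtr_sqr.
Qed.

Lemma enormN x : enorm (- x) = enorm x.
Proof. by rewrite -scaleN1r enormZ normrN1 mul1r. Qed.

Lemma dotp_le_enorm x y : dotp x y <= enorm x * enorm y.
Proof.
have [->|x0] := eqVneq x 0; first by rewrite dot0p mulr_ge0 ?enorm_ge0.
have [->|y0] := eqVneq y 0; first by rewrite dotpC dot0p mulr_ge0 ?enorm_ge0.
have xy0 : 0 < enorm x * enorm y by rewrite mulr_gt0 ?enorm_gt0.
have := dotp_ge0 (enorm y *: x - enorm x *: y).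
rewrite !(dotpBl, dotpBr, dotpZl, dotpZr) (dotpC y x) -!sqr_enorm.
have -> : enorm y * (enorm y * enorm x ^+ 2 - enorm x * dotp x y) -
  enorm x * (enorm y * dotp x y - enorm x * enorm y ^+ 2) =
  2 * (enorm x * enorm y) * (enorm x * enorm y - dotp x y) by ring.
by rewrite pmulr_rge0 ?subr_ge0// mulr_gt0.
Qed.

Lemma ler_enormD x y : enorm (x + y) <= enorm x + enorm y.
Proof.
rewrite -ler_sqr ?nnegrE ?addr_ge0 ?enorm_ge0// sqr_enorm dotpDl.
rewrite !(dotpC _ (x + y)) !dotpDl sqrrD -!sqr_enorm (dotpC y x).
by have := dotp_le_enorm x y; lra.
Qed.

Lemma ler_enorm_dist x y : `|enorm x - enorm y| <= enorm (x - y).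
Proof.
have enorm_sub u v : enorm u - enorm v <= enorm (u - v).
  by rewrite lerBlDr (le_trans _ (ler_enormD _ _))// subrK.
by rewrite ler_norml enorm_sub andbT lerNl opprB -(enormN (x - y)) opprB.
Qed.

Lemma enorm_le_norm x : enorm x <= n%:R * `|x|.
Proof.
rewrite -ler_sqr ?nnegrE ?enorm_ge0 ?mulr_ge0// sqr_enorm.
apply: (@le_trans _ _ (\sum_(i < n) `|x| ^+ 2)).
  apply: ler_sum => i _; rewrite -expr2 -real_normK ?num_real//.
  by rewrite ler_sqr ?nnegrE// ler_row_norm.
rewrite sumr_const card_ord -[leLHS]mulr_natl exprMn ler_wpM2r ?sqr_ge0//.
by rewrite -natrX ler_nat; case: (n) => // m; rewrite expnS leq_pmulr.
Qed.

Lemma lipschitz_enorm : lipschitz enorm.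
Proof.
apply/lipschitzP; exists n%:R => // x y.
exact: le_trans (ler_enorm_dist _ _) (enorm_le_norm _).
Qed.

Lemma lipschitz_dotp x : lipschitz (dotp x).
Proof.
apply/lipschitzP; exists (\sum_i `|x ord0 i|) => [|y z]; first exact: sumr_ge0.
rewrite -dotpBr mulr_suml (le_trans (ler_norm_sum _ _ _))//.
by apply: ler_sum => i _; rewrite normrM ler_wpM2l// ler_row_norm.
Qed.

End Dotp.

Definition vcons n (s : R) (x : 'rV[R]_n) : 'rV[R]_n.+1 :=
  \row_i oapp (x ord0) s (unlift ord0 i).

Definition vtail n (x : 'rV[R]_n.+1) : 'rV[R]_n := \row_j x ord0 (lift ord0 j).

Lemma vcons0 n s (x : 'rV[R]_n) : vcons s x ord0 ord0 = s.
Proof. by rewrite mxE unlift_none. Qed.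

Lemma vconsS n s (x : 'rV[R]_n) j : vcons s x ord0 (lift ord0 j) = x ord0 j.
Proof. by rewrite mxE liftK. Qed.

Lemma vconsK n s (x : 'rV[R]_n) : vtail (vcons s x) = x.
Proof. by apply/rowP => j; rewrite mxE vconsS. Qed.

Lemma vconsB n s t (x y : 'rV[R]_n) :
  vcons s x - vcons t y = vcons (s - t) (x - y).
Proof.
by apply/rowP => i; rewrite !mxE; case: unliftP => [j|] _ /=; rewrite ?mxE.
Qed.

Lemma ler_norm_vcons n s (x : 'rV[R]_n) : `|vcons s x| <= `|s| + `|x|.
Proof.
apply: row_norm_le => [|i]; first exact: addr_ge0.
case: (unliftP ord0 i) => [j|] ->; last by rewrite vcons0 lerDl.
by rewrite vconsS (le_trans (ler_row_norm _ _))// lerDr.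
Qed.

Lemma dotp_vcons n (x : 'rV[R]_n.+1) s (y : 'rV[R]_n) :
  dotp x (vcons s y) = x ord0 ord0 * s + dotp (vtail x) y.
Proof.
rewrite /dotp big_ord_recl vcons0; congr (_ + _).
by apply: eq_bigr => i _; rewrite vconsS mxE.
Qed.

Lemma vcons_vtail n (x : 'rV[R]_n.+1) : vcons (x ord0 ord0) (vtail x) = x.
Proof.
apply/rowP => i; case: (unliftP ord0 i) => [j|] ->; last by rewrite vcons0.
by rewrite vconsS mxE.
Qed.

Lemma enorm_vcons n s (x : 'rV[R]_n) :
  enorm (vcons s x) = Num.sqrt (s ^+ 2 + enorm x ^+ 2).
Proof. by rewrite {1}/enorm dotp_vcons vcons0 vconsK sqr_enorm expr2. Qed.

Lemma enorm_vcons_nil s (x : 'rV[R]_0) : enorm (vcons s x) = `|s|.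
Proof. by rewrite enorm_vcons sqr_enorm /dotp big_ord0 addr0 sqrtr_sqr. Qed.

End EuclideanNorm.
Arguments lipschitz_enorm {R n}.

(** * Gaussian means of functions of a vector *)

Section GaussMeanv.
Variable R : realType.

Fixpoint gauss_meanv n : ('rV[R]_n -> R) -> R :=
  match n return ('rV[R]_n -> R) -> R with
  | 0 => fun f => f 0
  | n'.+1 => fun f => gauss_mean (fun s => gauss_meanv (fun x => f (vcons s x)))
  end.

Lemma gauss_meanv0 (f : 'rV[R]_0 -> R) : gauss_meanv f = f 0.
Proof. by []. Qed.

Lemma gauss_meanvS n (f : 'rV[R]_n.+1 -> R) :
  gauss_meanv f = gauss_mean (fun s => gauss_meanv (fun x => f (vcons s x))).
Proof. by []. Qed.

Section Theory.
Variable n : nat.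
Implicit Types f h : 'rV[R]_n -> R.

Lemma eq_gauss_meanv f h : f =1 h -> gauss_meanv f = gauss_meanv h.
Proof. by move=> /funext->. Qed.

Lemma lipschitz_vcons (f : 'rV[R]_n.+1 -> R) s :
  lipschitz f -> lipschitz (fun x => f (vcons s x)).
Proof.
move=> /lipschitz_comp; apply; apply/lipschitzP; exists 1 => // x y.
by rewrite vconsB subrr mul1r (le_trans (ler_norm_vcons _ _))// normr0 add0r.
Qed.

Lemma lipschitz_vcons_head (M : ('rV[R]_n -> R) -> R) (f : 'rV[R]_n.+1 -> R) :
  (forall h k e, lipschitz h -> lipschitz k -> (forall x, `|h x - k x| <= e) ->
    `|M h - M k| <= e) ->
  lipschitz f -> lipschitz (fun s => M (fun x => f (vcons s x))).
Proof.
move=> M_dist lf; have /lipschitzP[L L0 fL] := lf.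
apply/lipschitzP; exists L => // s t; apply: M_dist => [||x].
- exact: lipschitz_vcons.
- exact: lipschitz_vcons.
rewrite (le_trans (fL _ _))// ler_wpM2l// vconsB subrr.
by rewrite (le_trans (ler_norm_vcons _ _))// normr0 addr0.
Qed.

End Theory.

Lemma gauss_meanv_cst n c : gauss_meanv (fun _ : 'rV[R]_n => c) = c.
Proof.
elim: n => [//|n IH]; rewrite gauss_meanvS.
by under eq_gauss_mean do rewrite IH; exact: gauss_mean_cst.
Qed.

Lemma gauss_meanv_dist n (f h : 'rV[R]_n -> R) e : lipschitz f -> lipschitz h ->
  (forall x, `|f x - h x| <= e) -> `|gauss_meanv f - gauss_meanv h| <= e.
Proof.
elim: n f h e => [|n IH] f h e lf lh fh; first exact: fh.
rewrite !gauss_meanvS; apply: gauss_mean_dist => [||s].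
- exact: lipschitz_vcons_head.
- exact: lipschitz_vcons_head.
by apply: IH => //; exact: lipschitz_vcons.
Qed.

Lemma lipschitz_gauss_meanv n (f : 'rV[R]_n.+1 -> R) :
  lipschitz f -> lipschitz (fun s => gauss_meanv (fun x => f (vcons s x))).
Proof. by apply: lipschitz_vcons_head => *; exact: gauss_meanv_dist. Qed.

Lemma gauss_meanv_le n (f h : 'rV[R]_n -> R) : lipschitz f -> lipschitz h ->
  (forall x, f x <= h x) -> gauss_meanv f <= gauss_meanv h.
Proof.
elim: n f h => [|n IH] f h lf lh fh; first exact: fh.
rewrite !gauss_meanvS; apply: gauss_mean_le => [||s].
- exact: lipschitz_gauss_meanv.
- exact: lipschitz_gauss_meanv.
by apply: IH => //; exact: lipschitz_vcons.
Qed.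

Lemma gauss_meanv_ge0 n (f : 'rV[R]_n -> R) :
  lipschitz f -> (forall x, 0 <= f x) -> 0 <= gauss_meanv f.
Proof.
move=> lf f0; rewrite -(gauss_meanv_cst n 0) gauss_meanv_le//.
exact: lipschitz_cst.
Qed.

Lemma gauss_meanvD n (f h : 'rV[R]_n -> R) : lipschitz f -> lipschitz h ->
  gauss_meanv (fun x => f x + h x) = gauss_meanv f + gauss_meanv h.
Proof.
elim: n f h => [//|n IH] f h lf lh; rewrite !gauss_meanvS.
rewrite -gauss_meanD; try exact: lipschitz_gauss_meanv.
by apply: eq_gauss_mean => s; rewrite IH//; exact: lipschitz_vcons.
Qed.

Lemma gauss_meanvZ n c (f : 'rV[R]_n -> R) : lipschitz f ->
  gauss_meanv (fun x => c * f x) = c * gauss_meanv f.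
Proof.
elim: n f => [//|n IH] f lf; rewrite !gauss_meanvS.
rewrite -gauss_meanZ; last exact: lipschitz_gauss_meanv.
by apply: eq_gauss_mean => s; rewrite IH//; exact: lipschitz_vcons.
Qed.

Lemma gauss_meanv_sum n I (r : seq I) (f : I -> 'rV[R]_n -> R) :
  (forall i, lipschitz (f i)) ->
  gauss_meanv (fun x => \sum_(i <- r) f i x) = \sum_(i <- r) gauss_meanv (f i).
Proof.
move=> lf; elim: r => [|i r IH].
  by rewrite big_nil; under eq_gauss_meanv do rewrite big_nil;
    exact: gauss_meanv_cst.
rewrite big_cons -IH -gauss_meanvD//; last exact: lipschitz_sum.
by apply: eq_gauss_meanv => x; rewrite big_cons.
Qed.

Lemma gauss_meanv_dotp n (F : R -> R) (v : 'rV[R]_n) :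
  lipschitz F -> (forall x, 0 <= F x) ->
  gauss_meanv (fun x => F (dotp v x)) = gauss_mean (fun z => F (enorm v * z)).
Proof.
elim: n F v => [|n IH] F v lF F0.
  rewrite gauss_meanv0 /enorm /dotp !big_ord0 sqrtr0.
  by under eq_gauss_mean do rewrite mul0r; rewrite gauss_mean_cst.
rewrite gauss_meanvS -{2}(vcons_vtail v) enorm_vcons -gauss_mean_stable//.
apply: eq_gauss_mean => s; under eq_gauss_meanv do rewrite dotp_vcons addrC.
rewrite (IH (fun x => F (x + v ord0 ord0 * s)))//.
apply: lipschitz_comp lF _.
by under eq_fun do rewrite -[X in X + _]mul1r; exact: lipschitz_affine.
Qed.

Lemma lipschitz_normr_dotp n (v : 'rV[R]_n) : lipschitz (fun x => `|dotp v x|).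
Proof. exact: lipschitz_comp lipschitz_normr (lipschitz_dotp v). Qed.

Lemma gauss_meanv_normr_dotp n (v : 'rV[R]_n) :
  gauss_meanv (fun x => `|dotp v x|) = enorm v / Num.sqrt pi.
Proof.
rewrite (@gauss_meanv_dotp _ (fun z => `|z|))//; last exact: lipschitz_normr.
rewrite -gauss_mean_normr -gauss_meanZ; last exact: lipschitz_normr.
by apply: eq_gauss_mean => x; rewrite normrM ger0_norm// enorm_ge0.
Qed.

End GaussMeanv.

(** * Polar coordinates and radial functions *)

Section Radial.
Variable R : realType.
Implicit Types F : R -> R.
Notation mu := (@lebesgue_measure R).
Notation g := (@gauss_fun R).
Notation radius s r := (Num.sqrt (s ^+ 2 + r ^+ 2)).

Lemma radiusM s y : radius s (s * y) = `|s| * radius 1 y :> R.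
Proof.
by rewrite -sqrtr_sqr -sqrtrM ?sqr_ge0// mulrDr expr1n mulr1 exprMn.
Qed.

Lemma radius1_gt0 y : 0 < radius 1 y :> R.
Proof. by rewrite sqrtr_gt0 expr1n ltr_pwDl ?sqr_ge0. Qed.

Lemma continuous_radius s : continuous (fun r : R => radius s r).
Proof.
move=> r; apply: continuous_comp; last exact: sqrt_continuous.
by apply: cvgD; [exact: cvg_cst|exact: exprn_continuous].
Qed.

Definition slope_factor n : \bar R :=
  (\int[mu]_y (`|y| ^+ n / radius 1 y ^+ n.+2)%:E)%E.

Lemma slope_factor_ge0 n : (0 <= slope_factor n)%E.
Proof.
by apply: integral_ge0 => y _; rewrite lee_fin divr_ge0 ?exprn_ge0 ?sqrtr_ge0.
Qed.

Section PolarIntegral.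
Variables (G : R -> R) (n : nat).
Hypotheses (cG : continuous G) (G0 : forall x, 0 <= G x).

Let plane (p : R * R) : R := G (radius p.1 p.2) * `|p.2| ^+ n.

Let cone (p : R * R) : R :=
  G (`|p.1| * radius 1 p.2) * `|p.1| ^+ n.+1 * `|p.2| ^+ n.

Let plane_ge0 p : (0 <= (EFin \o plane) p)%E.
Proof. by rewrite lee_fin mulr_ge0 ?exprn_ge0. Qed.

Let cone_ge0 p : (0 <= (EFin \o cone) p)%E.
Proof. by rewrite lee_fin !mulr_ge0 ?exprn_ge0. Qed.

Let measurable_normX_comp (f : R * R -> R) k : measurable_fun setT f ->
  measurable_fun setT (fun p => `|f p| ^+ k).
Proof.
apply: (@measurableT_comp _ _ _ _ _ _ (fun r : R => `|r| ^+ k)).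
by apply: continuous_measurable_fun; exact: continuous_normX.
Qed.

Lemma measurable_radiusM :
  measurable_fun setT (fun p : R * R => (G (radius p.1 p.2) * `|p.2| ^+ n)%:E).
Proof.
apply/measurable_EFinP; apply: measurable_funM;
  last exact: measurable_normX_comp.
apply: (@measurableT_comp _ _ _ _ _ _ G);
  first exact: continuous_measurable_fun.
apply: (@measurableT_comp _ _ _ _ _ _ (@Num.sqrt R)).
  by apply: continuous_measurable_fun; exact: sqrt_continuous.
by apply: measurable_funD; apply: measurable_funX.
Qed.

Let measurable_cone : measurable_fun setT (EFin \o cone).
Proof.
apply/measurable_EFinP; apply: measurable_funM; last first.
  exact: measurable_normX_comp.
apply: measurable_funM; last first.
  exact: measurable_normX_comp.
apply: (@measurableT_comp _ _ _ _ _ _ G);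
  first exact: continuous_measurable_fun.
apply: measurable_funM; first exact: (@measurable_normX_comp fst 1).
apply: (@measurableT_comp _ _ _ _ _ _ (fun y : R => radius 1 y)) => //.
by apply: continuous_measurable_fun; exact: continuous_radius.
Qed.

Let integral_cone_line s : s != 0 ->
  (\int[mu]_r (EFin \o plane) (s, r) = \int[mu]_y (EFin \o cone) (s, y))%E.
Proof.
move=> s0;
  rewrite (@ge0_integral_affine _ (fun r => G (radius s r) * `|r| ^+ n) s 0)//.
- apply: eq_integral => y _;
    rewrite /cone /= addr0 radiusM normrM exprMn (exprS `|s|).
  by congr EFin; ring.
- move=> r; apply: cvgM; last exact: continuous_normX.
  by apply: continuous_comp; [exact: continuous_radius|exact: cG].
- by move=> r; rewrite mulr_ge0 ?exprn_ge0.
Qed.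

Let integral_cone_ray y :
  (\int[mu]_s (EFin \o cone) (s, y) = (`|y| ^+ n / radius 1 y ^+ n.+2)%:E *
   \int[mu]_r (G `|r| * `|r| ^+ n.+1)%:E)%E.
Proof.
have q0 := radius1_gt0 y; have qn0 := exprn_gt0 n.+1 q0.
have cray : continuous (fun r : R => G `|r| * `|r| ^+ n.+1).
  move=> r; apply: cvgM; last exact: continuous_normX.
  by apply: continuous_comp; [exact: norm_continuous|exact: cG].
rewrite (@ge0_integral_affine _ (fun r => G `|r| * `|r| ^+ n.+1) (radius 1 y)
  0)//.
- rewrite -ge0_integralZl//.
  + apply: eq_integral => s _; rewrite /cone -EFinM; congr EFin.
    rewrite /= addr0 normrM gtr0_norm// mulrC (mulrC `|s|) exprMn
      (exprS _ n.+1).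
    by field; rewrite !gt_eqF.
  + apply/measurable_EFinP/measurable_funM => //;
      apply: continuous_measurable_fun.
    exact: continuous_comp_affine cray.
  + by move=> s _; rewrite lee_fin !mulr_ge0 ?exprn_ge0.
- by rewrite gt_eqF.
- by move=> r; rewrite mulr_ge0 ?exprn_ge0.
Qed.

(* Polar coordinates with the slope [y = r / s] instead of the angle. *)
Lemma integral_polar :
  (\int[mu]_s \int[mu]_r (G (radius s r) * `|r| ^+ n)%:E =
   slope_factor n * \int[mu]_r (G `|r| * `|r| ^+ n.+1)%:E)%E.
Proof.
transitivity (\int[mu]_s \int[mu]_y (EFin \o cone) (s, y))%E.
  apply: ge0_ae_eq_integral => //.
  - exact: measurable_integral_snd measurable_radiusM plane_ge0.
  - exact: measurable_integral_snd measurable_cone cone_ge0.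
  - by move=> s _; apply: integral_ge0 => r _; exact: (plane_ge0 (s, r)).
  - by move=> s _; apply: integral_ge0 => y _; exact: (cone_ge0 (s, y)).
  exists [set 0]; split => //; first exact: lebesgue_measure_set1.
  by apply: subsetCl => s /eqP s0 _; exact: integral_cone_line.
rewrite lebesgue_fubini_tonelli//.
under eq_integral do rewrite integral_cone_ray.
rewrite ge0_integralZr//.
- apply/measurable_EFinP/measurable_funM.
    by apply: continuous_measurable_fun; exact: continuous_normX.
  apply: continuous_measurable_fun => y; apply: cvgV.
    by rewrite gt_eqF// exprn_gt0// radius1_gt0.
  apply: (@continuous_comp _ _ _ (fun y : R => radius 1 y)
    (fun x => x ^+ n.+2)).
    exact: continuous_radius.
  exact: exprn_continuous.
- by apply: integral_ge0 => r _; rewrite lee_fin mulr_ge0 ?exprn_ge0.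
Qed.

End PolarIntegral.

Lemma lipschitz_radius s : lipschitz (fun r : R => radius s r).
Proof.
have radiusE r : radius s r = enorm (vcons s (vcons r (0 : 'rV[R]_0))).
  by rewrite enorm_vcons enorm_vcons_nil real_normK ?num_real.
apply/lipschitzP; exists 1 => // x y; rewrite !radiusE mul1r.
rewrite (le_trans (ler_enorm_dist _ _))// !vconsB subrr enorm_vcons
  enorm_vcons_nil.
by rewrite expr0n add0r sqrtr_sqr normr_id.
Qed.

Lemma gauss_fun_radius s r : g (radius s r) = g r * g s.
Proof.
by rewrite /gauss_fun -expRD sqr_sqrtr ?addr_ge0 ?sqr_ge0// opprD addrC.
Qed.

(* Induction on [n] only yields some factor, a priori infinite; its value
   follows from the case [F = 1]. *)
Definition radial_factor n (C : \bar R) : Prop :=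
  forall F, lipschitz F -> (forall x, 0 <= F x) ->
  ((gauss_meanv (fun x : 'rV[R]_n.+1 => F (enorm x)))%:E =
    C * \int[mu]_r (F `|r| * `|r| ^+ n * g r)%:E)%E.

Lemma radial_factor0 : radial_factor 0 (Num.sqrt pi)^-1%:E.
Proof.
move=> F lF F0; rewrite gauss_meanvS.
under eq_gauss_mean do rewrite gauss_meanv0 enorm_vcons_nil.
rewrite gauss_meanE; last exact: lipschitz_comp lF lipschitz_normr.
by congr (_ * _)%E; apply: eq_integral => r _; rewrite expr0 mulr1.
Qed.

Lemma radial_factorS n C : (0 <= C)%E -> radial_factor n C ->
  radial_factor n.+1 ((Num.sqrt pi)^-1%:E * (C * slope_factor n)).
Proof.
move=> C0 meanE F lF F0; pose G t := F t * g t.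
have cG : continuous G.
  by move=> t; apply: cvgM;
    [exact: lipschitz_continuous|exact: continuous_gauss_fun].
have G0 t : 0 <= G t by rewrite mulr_ge0 ?gauss_fun_ge0.
have lFe : lipschitz (fun x : 'rV[R]_n.+2 => F (enorm x)).
  exact: lipschitz_comp lF lipschitz_enorm.
rewrite gauss_meanvS gauss_meanE; last exact: (lipschitz_gauss_meanv lFe).
rewrite -!muleA; congr (_ * _)%E.
transitivity (\int[mu]_s (C * \int[mu]_r (G (radius s r) * `|r| ^+ n)%:E))%E.
  apply: eq_integral => s _; have lFs := lipschitz_comp lF (lipschitz_radius s).
  under eq_gauss_meanv do rewrite enorm_vcons.
  rewrite EFinM (meanE _ lFs)// -muleA -ge0_integralZr//.
  - congr (_ * _)%E; apply: eq_integral => r _.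
    by rewrite real_normK ?num_real// -EFinM /G gauss_fun_radius; congr EFin;
      ring.
  - apply/measurable_EFinP/measurable_funM; last exact: measurable_gauss_fun.
    apply: continuous_measurable_fun => r; apply: cvgM;
      last exact: continuous_normX.
    apply: (@continuous_comp _ _ _ (fun r : R => `|r|)
      (fun r => F (radius s r))).
      exact: norm_continuous.
    exact: lipschitz_continuous.
  - by move=> r _; rewrite lee_fin !mulr_ge0 ?exprn_ge0 ?gauss_fun_ge0.
  - by rewrite lee_fin gauss_fun_ge0.
rewrite ge0_integralZl//; last 2 first.
- apply: (measurable_integral_snd (measurable_radiusM n cG)) => p.
  by rewrite lee_fin mulr_ge0 ?exprn_ge0.
- by move=> s _; apply: integral_ge0 => r _;
    rewrite lee_fin mulr_ge0 ?exprn_ge0.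
rewrite integral_polar//; congr (_ * (_ * _))%E.
by apply: eq_integral => r _;
  rewrite /G /gauss_fun real_normK ?num_real// mulrAC.
Qed.

Lemma ex_radial_factor n : exists2 C, (0 <= C)%E & radial_factor n C.
Proof.
have sV0 : (0 <= (Num.sqrt pi)^-1%:E :> \bar R)%E
  by rewrite lee_fin invr_ge0 sqrtr_ge0.
elim: n => [|n [C C0 factorC]].
  by exists (Num.sqrt pi)^-1%:E; last exact: radial_factor0.
exists ((Num.sqrt pi)^-1%:E * (C * slope_factor n))%E;
  last exact: radial_factorS.
by rewrite !mule_ge0// slope_factor_ge0.
Qed.

Lemma gauss_meanv_enorm n F : lipschitz F -> (forall x, 0 <= F x) ->
  ((gauss_meanv (fun x : 'rV[R]_n.+1 => F (enorm x)))%:E * gauss_moment R n =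
   \int[mu]_r (F `|r| * `|r| ^+ n * g r)%:E)%E.
Proof.
move=> lF F0; have [C _ meanE] := ex_radial_factor n.
have := meanE (fun=> 1) (lipschitz_cst _) (fun=> ler01);
  rewrite gauss_meanv_cst.
under eq_integral do rewrite mul1r.
by rewrite -/(gauss_moment R n) meanE// muleAC => <-; rewrite mul1e.
Qed.

End Radial.

(** * Gaussian moments and the Gamma function *)

Section GaussMoments.
Variable R : realType.
Notation mu := (@lebesgue_measure R).
Notation g := (@gauss_fun R).

(* [exp (x ^ 2) >= x ^ (2 k + 2) / (k + 1)!] *)
Lemma cvg_normX_gauss k : `|x| ^+ k * g x @[x --> +oo] --> (0 : R).
Proof.
apply: (@squeeze_cvgr _ _ _ _ (cst 0) (fun x => k.+1`!%:R * x^-1)).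
- near=> x; rewrite normX_gauss_ge0 /=.
  have x1 : 1 <= x by near: x; apply: nbhs_pinfty_ge; exact: num_real.
  have x0 : 0 < x by exact: lt_le_trans x1.
  rewrite gtr0_norm// /gauss_fun expRN -ler_pdivlMr ?invr_gt0 ?expR_gt0// invrK.
  have f0 : 0 < k.+1`!%:R :> R by rewrite ltr0n fact_gt0.
  rewrite mulrAC ler_pdivlMr// -exprSr.
  have x_le_sqr : x ^+ k.+1 <= (x ^+ 2) ^+ k.+1.
    by rewrite lerXn2r ?nnegrE ?sqr_ge0 ?(ltW x0)// expr2 ler_peMl// ltW.
  apply: (le_trans x_le_sqr); rewrite mulrC -ler_pdivrMr//.
  by apply: le_trans (expR_ge1Dxn k (sqr_ge0 x)); rewrite lerDr.
- exact: cvg_cst.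
- rewrite -[X in _ --> X](mulr0 k.+1`!%:R); apply: cvgMl_tmp.
  apply/gtr0_cvgV0; last exact: cvg_id.
  by near=> x; near: x; apply: nbhs_pinfty_gt; exact: num_real.
Unshelve. all: by end_near. Qed.

Let integral_truncated_by_parts k b : 0 <= b ->
  (\int[mu]_(x in `[0%R, b]) (`|x| ^+ k.+2 * g x)%:E =
   (- (`|b| ^+ k.+1 * g b / 2))%:E +
   (k.+1%:R / 2)%:E * \int[mu]_(x in `[0%R, b]) (`|x| ^+ k * g x)%:E)%E.
Proof.
rewrite le_eqVlt => /predU1P[<-|b0].
  by rewrite set_itv1 !integral_set1 normr0 expr0n !mul0r oppr0 mule0 adde0.
transitivity (\int[mu]_(x in `[0%R, b]) (x ^+ k.+1 * (x * g x))%:E)%E.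
  apply: eq_integral => x; rewrite inE/= in_itv/= => /andP[x0 _].
  by rewrite ger0_norm// mulrA -exprSr.
rewrite (@integration_by_parts R _ (fun x => - g x / 2)
  (fun x => k.+1%:R * x ^+ k))//.
- congr (_ + _)%E.
    by rewrite expr0n mul0r subr0 gtr0_norm// mulrA mulrN mulNr.
  rewrite -[RHS]oppeK -mulNe -EFinN -integralZl//.
    congr (- _)%E; apply: eq_integral => x;
      rewrite inE/= in_itv/= => /andP[x0 _].
    by rewrite ger0_norm// -EFinM; congr EFin; field.
  apply: continuous_compact_integrable; first exact: segment_compact.
  by apply: continuous_subspaceT; exact: continuous_normX_gauss.
- apply: continuous_subspaceT => x; apply: cvgMl_tmp; exact: exprn_continuous.
- split.
  + by move=> x _; exact: exprn_derivable.
  + by apply: cvg_at_right_filter; exact: exprn_continuous.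
  + by apply: cvg_at_left_filter; exact: exprn_continuous.
- by move=> x _; rewrite exp_derive1.
- apply: continuous_subspaceT => x.
  by apply: cvgM; [exact: cvg_id|exact: continuous_gauss_fun].
- split.
  + by move=> x _; case: (is_derive_gauss_primitive x).
  + apply: cvg_at_right_filter; apply: cvgMr_tmp; apply: cvgN.
    exact: continuous_gauss_fun.
  + apply: cvg_at_left_filter; apply: cvgMr_tmp; apply: cvgN.
    exact: continuous_gauss_fun.
- by move=> x _; rewrite derive1E; case: (is_derive_gauss_primitive x).
Qed.

Lemma gauss_momentSS k :
  gauss_moment R k.+2 = ((k.+1%:R / 2)%:E * gauss_moment R k)%E.
Proof.
have cvg_truncated j :
    (\int[mu]_(x in `[0%R, n%:R]) (`|x| ^+ j * g x)%:E @[n --> \oo] -->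
     \int[mu]_(x in `[0%R, +oo[) (`|x| ^+ j * g x)%:E)%E.
  apply: ge0_cvgn_integral => [x|]; first exact: normX_gauss_ge0.
  by apply: continuous_measurable_fun; exact: continuous_normX_gauss.
have boundary_cvg0 : (- (`|n%:R| ^+ k.+1 * g n%:R / 2))%:E @[n --> \oo] --> 0%E.
  apply: cvg_EFin; first exact: nearW.
  rewrite -[0](@oppr0 R) -[X in - X](mul0r 2^-1); apply: cvgN; apply: cvgMr_tmp.
  exact: (iffLR (cvg_pinftyP _ _) (cvg_normX_gauss k.+1) _ cvgr_idn).
rewrite !gauss_moment_halfline muleCA; congr (_ * _)%E.
rewrite -(cvg_lim _ (cvg_truncated k.+2))//; apply/cvg_lim => //.
under eq_fun do rewrite integral_truncated_by_parts//.
have cvg_rhs := cvgeZl (isT : (k.+1%:R / 2)%:E \is a fin_num) (cvg_truncated k).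
have fin0 : (0 : \bar R)%E \is a fin_num by [].
have := cvgeD (fin_num_adde_defr _ fin0) boundary_cvg0 cvg_rhs.
by rewrite add0e; apply; exact: eventually_filter.
Qed.

End GaussMoments.

Section GammaMoments.
Variable R : realType.
Implicit Types G : R -> R.
Notation mu := (@lebesgue_measure R).

Let integral_sqr_truncated G (b : R) : continuous G -> 0 <= b ->
  (\int[mu]_(x in `[0%R, (b ^+ 2)%R]) (G x)%:E =
   \int[mu]_(x in `[0%R, b]) (G (x ^+ 2) * (2 * `|x|))%:E)%E.
Proof.
move=> cG b0; have sqr'E : (fun x : R => x ^+ 2)^`()%classic = (fun x => 2 * x).
  by apply/funext => x; rewrite exp_derive1 expr1.
have csqr' : continuous (fun x : R => x ^+ 2)^`()%classic.
  by rewrite sqr'E => x; apply: cvgMl_tmp; exact: cvg_id.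
have := @integration_by_substitution_increasing R (fun x => x ^+ 2) G 0 b b0.
rewrite expr0n => ->.
- apply: eq_integral => x; rewrite inE/= in_itv/= => /andP[x0 _].
  by rewrite sqr'E ger0_norm.
- by move=> x y /[!in_itv]/= /andP[x0 _] /andP[y0 _] xy; rewrite ltr_pXn2r.
- by move=> x _; exact: csqr'.
- by apply: cvgP; apply: cvg_at_right_filter; exact: csqr'.
- by apply: cvgP; apply: cvg_at_left_filter; exact: csqr'.
- split=> [x _||]; first exact: exprn_derivable.
  + by apply: cvg_at_right_filter; exact: exprn_continuous.
  + by apply: cvg_at_left_filter; exact: exprn_continuous.
- exact: continuous_subspaceT.
Qed.

Lemma integral_sqr_substitution G : continuous G -> (forall x, 0 <= G x) ->
  (\int[mu]_(x in `[0%R, +oo[) (G x)%:E =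
   \int[mu]_(x in `[0%R, +oo[) (G (x ^+ 2) * (2 * `|x|))%:E)%E.
Proof.
move=> cG G0; pose H x := G (x ^+ 2) * (2 * `|x|).
have cH : continuous H.
  move=> x; apply: cvgM; last by apply: cvgMl_tmp; exact: norm_continuous.
  by apply: continuous_comp; [exact: exprn_continuous|exact: cG].
have H0 x : 0 <= H x by rewrite mulr_ge0// mulr_ge0.
have cvg_truncated (K : R -> R) : continuous K -> (forall x, 0 <= K x) ->
    (\int[mu]_(x in `[0%R, n%:R]) (K x)%:E @[n --> \oo] -->
     \int[mu]_(x in `[0%R, +oo[) (K x)%:E)%E.
  by move=> cK K0; apply: ge0_cvgn_integral => //;
    exact: continuous_measurable_fun.
rewrite -(cvg_lim _ (cvg_truncated _ cH H0))//; apply/esym/cvg_lim => //.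
under eq_fun do rewrite -integral_sqr_truncated// -natrX.
apply: (cvg_comp (fun n => n ^ 2)%N _ _ (cvg_truncated _ cG G0)).
apply/cvgnyPge => m; near=> n.
have : (m <= n)%N by near: n; exact: nbhs_infty_ge.
by move=> /leq_trans; apply; rewrite -mulnn; case: (n) => // n';
  exact: leq_pmulr.
Unshelve. all: by end_near. Qed.

Lemma Gamma_half k : Gamma (k.+2%:R / 2) = fine (gauss_moment R k.+1) :> R.
Proof.
pose G t : R := Num.sqrt t ^+ k * expR (- t).
have cG : continuous G.
  move=> x; apply: cvgM.
    apply: (@continuous_comp _ _ _ Num.sqrt (fun r => r ^+ k)).
      exact: sqrt_continuous.
    exact: exprn_continuous.
  by apply: continuous_comp; [exact: opp_continuous|exact: continuous_expR].
have G0 t : 0 <= G t by rewrite mulr_ge0 ?exprn_ge0 ?sqrtr_ge0 ?expR_ge0.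
congr fine; rewrite gauss_moment_halfline -ge0_integralZl//; last 2 first.
- apply/measurable_EFinP; apply: measurable_funTS;
    apply: continuous_measurable_fun.
  exact: continuous_normX_gauss.
- by move=> x _; rewrite lee_fin normX_gauss_ge0.
transitivity (\int[mu]_(t in `[0%R, +oo[) (G t)%:E)%E.
  rewrite -integral_itv_obnd_cbnd; last first.
    by apply/measurable_EFinP; apply: measurable_funTS;
      exact: continuous_measurable_fun.
  apply: eq_integral => t; rewrite inE/= in_itv/= andbT => t0.
  have -> : k.+2%:R / 2 - 1 = 2^-1 * k%:R :> R by rewrite -addn2 natrD; field.
  by rewrite powRrM powR12_sqrt ?(ltW t0)// powR_mulrn ?sqrtr_ge0.
rewrite integral_sqr_substitution//; apply: eq_integral => x _.
by rewrite -EFinM /G sqrtr_sqr /gauss_fun (exprS _ k); congr EFin; ring.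
Qed.

End GammaMoments.

(** * The mean norm of a Gaussian vector *)

Section MeanNorm.
Variable R : realType.

Lemma gauss_moment_EFin k : exists2 m : R, 0 < m & gauss_moment R k = m%:E.
Proof.
elim/ltn_ind: k => -[_|[_|k IH]].
- by exists (Num.sqrt pi); [exact: sqrt_pi_gt0|exact: gauss_moment0].
- by exists 1; last exact: gauss_moment1.
have [m m0 momentE] := IH k (leqnSn _).
exists (k.+1%:R / 2 * m); first by rewrite mulr_gt0 ?divr_gt0.
by rewrite gauss_momentSS momentE EFinM.
Qed.

Definition mean_norm n : R := gauss_meanv (@enorm R n).

Lemma mean_norm_moment n :
  ((mean_norm n.+1)%:E * gauss_moment R n = gauss_moment R n.+1)%E.
Proof.
have := @gauss_meanv_enorm R n (fun x => `|x|) lipschitz_normr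
  (fun=> normr_ge0 _).
under eq_gauss_meanv do rewrite ger0_norm ?enorm_ge0//.
by under eq_integral do rewrite normr_id -exprS.
Qed.

Lemma mean_norm_Gamma n : (2 <= n)%N ->
  mean_norm n = Gamma ((n%:R + 1) / 2) / Gamma (n%:R / 2).
Proof.
case: n => [//|[//|n]] _; rewrite natr1 !Gamma_half -mean_norm_moment.
have [m m0 ->] := gauss_moment_EFin n.+1.
by rewrite -EFinM /= mulfK// gt_eqF.
Qed.

Lemma mean_norm1 : mean_norm 1 = (Num.sqrt pi)^-1.
Proof.
have := mean_norm_moment 0; rewrite gauss_moment0 gauss_moment1 -EFinM => -[].
by move=> /(canRL (mulfK _)) ->; rewrite ?mul1r// gt_eqF ?sqrt_pi_gt0.
Qed.

Lemma mean_norm_ge0 n : 0 <= mean_norm n.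
Proof. by apply: gauss_meanv_ge0 lipschitz_enorm _ => x; exact: enorm_ge0. Qed.

Lemma mean_normMS n : mean_norm n.+1 * mean_norm n.+2 = n.+1%:R / 2.
Proof.
have [m m0 momentE] := gauss_moment_EFin n.
have := mean_norm_moment n.+1; rewrite -mean_norm_moment gauss_momentSS momentE.
rewrite -!EFinM => -[]; rewrite mulrA mulrC (mulrC (mean_norm n.+2)).
by rewrite mulrC => /(mulIf (lt0r_neq0 m0)).
Qed.

Lemma mean_norm_gt0 n : 0 < mean_norm n.+1.
Proof.
rewrite lt_neqAle mean_norm_ge0 andbT eq_sym; apply/eqP => mean0.
by have /eqP := mean_normMS n;
  rewrite mean0 mul0r eq_sym mulf_eq0 invr_eq0 !pnatr_eq0.
Qed.

Lemma mean_norm_nondecreasing n : mean_norm n <= mean_norm n.+1.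
Proof.
rewrite -(gauss_mean_cst (mean_norm n)); apply: gauss_mean_le => [||s].
- exact: lipschitz_cst.
- exact: (lipschitz_gauss_meanv lipschitz_enorm).
apply: gauss_meanv_le => [||x]; first exact: lipschitz_enorm.
  exact: (lipschitz_vcons s lipschitz_enorm).
rewrite enorm_vcons -[leLHS]ger0_norm ?enorm_ge0// -sqrtr_sqr.
by rewrite ler_wsqrtr// lerDr sqr_ge0.
Qed.

Lemma mean_norm2 : mean_norm 2 = pi / 2 * mean_norm 1.
Proof.
apply: (mulfI (lt0r_neq0 (mean_norm_gt0 0)));
  rewrite mean_normMS mulrCA mean_norm1.
by rewrite -invfM -expr2 sqr_sqrtr ?pi_ge0// mulrAC mulfV ?gt_eqF ?pi_gt0.
Qed.

Lemma mean_norm_succ_le n :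
  n.+1%:R * mean_norm n.+2 <= n.+2%:R * mean_norm n.+1.
Proof.
have natE k : k.+1%:R = 2 * (mean_norm k.+1 * mean_norm k.+2).
  by rewrite mean_normMS mulrC divfK.
rewrite (natE n) (natE n.+1); have := mean_norm_nondecreasing n.+2.
have xy0 : 0 <= mean_norm n.+1 * mean_norm n.+2
  by rewrite mulr_ge0 ?mean_norm_ge0.
by move=> /(ler_wpM2l xy0); lra.
Qed.

Lemma mean_norm_ratio n :
  (1 - 2 / pi) * mean_norm n.+2 ^+ 2 <= mean_norm n.+1 ^+ 2.
Proof.
have pi_lt := pi_lt_16_5 R; have pi0 := pi_gt0 R.
case: n => [|n].
  rewrite mean_norm2 exprMn mulrA ler_piMl ?sqr_ge0//.
  move: (@pi R) pi_lt pi0 => p p_lt p0.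
  have -> : (1 - 2 / p) * (p / 2) ^+ 2 = p * (p - 2) / 4
    by field; rewrite gt_eqF.
  nra.
have ratio_le : 1 - 2 / pi <= 4 / 9 :> R.
  rewrite lerBlDr -lerBlDl ler_pdivlMr//; lra.
apply: (@le_trans _ _ ((2 / 3 * mean_norm n.+3) ^+ 2)).
  by rewrite [leRHS]exprMn ler_wpM2r ?sqr_ge0//; lra.
have mean23_ge0 : 0 <= 2 / 3 * mean_norm n.+3.
  by apply: mulr_ge0; [exact: divr_ge0|exact: mean_norm_ge0].
rewrite ler_sqr ?nnegrE ?mean_norm_ge0// -(ler_pM2l (ltr0Sn R n.+2)).
apply: le_trans (mean_norm_succ_le n.+1);
  rewrite mulrA ler_wpM2r ?mean_norm_ge0//.
rewrite -addn3 -(addn2 n) (natrD _ n 3) (natrD _ n 2).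
by have := ler0n R n; lra.
Qed.

End MeanNorm.

(** * Orthogonal projections *)

Section OrthogonalProjection.
Variable R : realType.

(* For [w = 0] the quotient is [0], so that [householder 0] is the identity. *)
Definition householder n (w x : 'rV[R]_n) : 'rV[R]_n :=
  x - (2 * dotp x w / dotp w w) *: w.

Lemma dotp_householder n (w x y : 'rV[R]_n) :
  dotp x (householder w y) = dotp (householder w x) y.
Proof.
rewrite /householder dotpBl dotpBr dotpZl dotpZr (dotpC w y); congr (_ - _).
ring.
Qed.

Lemma householderK n (w : 'rV[R]_n) : involutive (householder w).
Proof.
move=> x; have [w0|w0] := eqVneq (dotp w w) 0.
  by rewrite /householder w0 invr0 !mulr0 !scale0r !subr0.
rewrite /householder dotpBl dotpZl divfK// -addrA -opprD -scalerDl -mulrDl.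
by rewrite [X in X / _](_ : _ = 0) ?mul0r ?scale0r ?subr0//; ring.
Qed.

Lemma householder_swap n (x y : 'rV[R]_n) : dotp x x = dotp y y ->
  householder (y - x) x = y.
Proof.
move=> xy; have [->|yx] := eqVneq y x.
  by rewrite /householder subrr scaler0 subr0.
have w0 : dotp (y - x) (y - x) != 0
  by rewrite -sqr_enorm sqrf_eq0 enorm_eq0 subr_eq0.
have coef : 2 * dotp x (y - x) = - dotp (y - x) (y - x).
  by rewrite !dotpBl !dotpBr xy (dotpC y x); ring.
by rewrite /householder coef mulNr divff// scaleN1r opprK addrC subrK.
Qed.

(* [A] embeds ['rV_k] isometrically onto the hyperplane orthogonal to [e]; its
   adjoint [B] is the projection along [e]. *)
Lemma orthogonal_projection k (e : 'rV[R]_k.+1) : dotp e e = 1 ->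
  exists (A : 'rV[R]_k -> 'rV[R]_k.+1) (B : 'rV[R]_k.+1 -> 'rV[R]_k),
  [/\ forall v x, dotp v (A x) = dotp (B v) x,
      forall x, enorm (A x) = enorm x &
      forall v, enorm v ^+ 2 = dotp v e ^+ 2 + enorm (B v) ^+ 2].
Proof.
move=> e1; pose e0 : 'rV[R]_k.+1 := vcons 1 0.
have dotp_e0 x : dotp x e0 = x ord0 ord0
  by rewrite dotp_vcons mulr1 dotpC dot0p addr0.
have e01 : dotp e0 e0 = 1 by rewrite dotp_e0 vcons0.
pose h := householder (e - e0).
have he0 : h e0 = e by apply: householder_swap; rewrite e01.
have hC x y : dotp x (h y) = dotp (h x) y by exact: dotp_householder.
have h_iso x : enorm (h x) = enorm x by rewrite /enorm hC [h (h x)]householderK.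
exists (fun x => h (vcons 0 x)), (fun v => vtail (h v)); split=> [v x|x|v].
- by rewrite hC dotp_vcons mulr0 add0r.
- by rewrite h_iso enorm_vcons expr0n add0r sqrtr_sqr ger0_norm ?enorm_ge0.
rewrite -(h_iso v) -{1}(vcons_vtail (h v)) enorm_vcons.
rewrite sqr_sqrtr ?addr_ge0 ?sqr_ge0//; congr (_ ^+ 2 + _).
by rewrite -dotp_e0 -hC he0.
Qed.

End OrthogonalProjection.

(** * Polygons of large width *)

Section Polygons.
Variable R : realType.

Lemma dist_le_variation (y : nat -> R) i j : (i <= j)%N ->
  `|y i - y j| <= \sum_(i <= k < j) `|y k - y k.+1|.
Proof.
elim: j => [|j IH].
  by rewrite leqn0 => /eqP->; rewrite subrr normr0 big_geq.
rewrite leq_eqVlt => /predU1P[->|ij]; first by rewrite subrr normr0 big_geq.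
rewrite big_nat_recr//=; apply: (le_trans (ler_distD (y j) _ _)).
by rewrite lerD2r IH.
Qed.

Lemma variation_ge (y : nat -> R) m p q : (p <= m)%N -> (q <= m)%N ->
  2 * `|y p - y q| - `|y 0%N - y m| <= \sum_(k < m) `|y k - y k.+1|.
Proof.
wlog pq : p q / (p <= q)%N => [hwlog pm qm|_ qm].
  by have [pq|/ltnW qp] := leqP p q;
    [exact: hwlog|rewrite distrC; exact: hwlog].
rewrite -(big_mkord xpredT (fun k => `|y k - y k.+1|)).
rewrite (big_cat_nat (n := p)) ?(leq_trans pq)//=
  (big_cat_nat (n := q) (m := p))//=.
have := dist_le_variation y (leq0n p); have := dist_le_variation y pq.
have := dist_le_variation y qm.
have := ler_distD (y 0%N) (y p) (y q); have := ler_distD (y m) (y 0%N) (y q).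
rewrite (distrC (y p) (y 0%N)) (distrC (y m) (y q)); lra.
Qed.

Definition polygon_length n (P : nat -> 'rV[R]_n) m : R :=
  \sum_(i < m) enorm (P i - P i.+1).

Definition polygon_width_ge n (P : nat -> 'rV[R]_n) m (T : R) : Prop :=
  forall u, exists p q,
    [/\ (p <= m)%N, (q <= m)%N & T * enorm u <= dotp (P p - P q) u].

Lemma polygon_variation_ge n (P : nat -> 'rV[R]_n) m T u :
  polygon_width_ge P m T ->
  2 * T * enorm u - `|dotp (P 0%N - P m) u| <=
  \sum_(i < m) `|dotp (P i - P i.+1) u|.
Proof.
move=> /(_ u)[p [q [pm qm wid]]]; under eq_bigr do rewrite dotpBl.
apply: le_trans (variation_ge (fun i => dotp (P i) u) pm qm).
rewrite -!dotpBl lerD2r -mulrA ler_wpM2l//.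
exact: le_trans wid (ler_norm _).
Qed.

Lemma projected_polygon_length_ge k n (P : nat -> 'rV[R]_n) m T
    (A : 'rV[R]_k -> 'rV[R]_n) (B : 'rV[R]_n -> 'rV[R]_k) :
  (forall v x, dotp v (A x) = dotp (B v) x) ->
  (forall x, enorm (A x) = enorm x) ->
  polygon_width_ge P m T ->
  2 * T * (Num.sqrt pi * mean_norm R k) - enorm (B (P 0%N - P m)) <=
  \sum_(i < m) enorm (B (P i - P i.+1)).
Proof.
move=> AB A_iso wid; have sp0 := sqrt_pi_gt0 R.
pose V x := \sum_(i < m) `|dotp (B (P i - P i.+1)) x|.
have lV : lipschitz V by apply: lipschitz_sum => i; exact: lipschitz_normr_dotp.
have lB := lipschitz_normr_dotp (B (P 0%N - P m)).
have le_mean : gauss_meanv (fun x : 'rV[R]_k => 2 * T * enorm x) <=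
    gauss_meanv (fun x => V x + `|dotp (B (P 0%N - P m)) x|).
  apply: gauss_meanv_le => [||x].
  - exact: lipschitzZ lipschitz_enorm.
  - exact: lipschitzD.
  rewrite -lerBlDr -AB -A_iso /V; under eq_bigr do rewrite -AB.
  exact: polygon_variation_ge.
move: le_mean; rewrite gauss_meanvZ; last exact: lipschitz_enorm.
rewrite gauss_meanvD// gauss_meanv_sum; last first.
  by move=> i; exact: lipschitz_normr_dotp.
rewrite gauss_meanv_normr_dotp
  (eq_bigr _ (fun i _ => gauss_meanv_normr_dotp _)).
rewrite -mulr_suml -mulrDl ler_pdivlMr// lerBlDr -/(mean_norm R k).
by rewrite -!mulrA (mulrC (mean_norm R k)).
Qed.

Lemma polygon_length_ge_endpoints n (P : nat -> 'rV[R]_n) m T :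
  polygon_width_ge P m T ->
  2 * T * (Num.sqrt pi * mean_norm R n) - enorm (P 0%N - P m) <=
  polygon_length P m.
Proof. exact: (@projected_polygon_length_ge _ _ _ _ _ id id). Qed.

Lemma sqrt_sum_sqr_le (I : Type) (r : seq I) (a b : I -> R) (D L : R) :
  0 <= D -> 0 <= L -> D <= \sum_(i <- r) a i -> L <= \sum_(i <- r) b i ->
  Num.sqrt (D ^+ 2 + L ^+ 2) <= \sum_(i <- r) Num.sqrt (a i ^+ 2 + b i ^+ 2).
Proof.
move=> D0 L0 Da Lb; set M := Num.sqrt _.
have M2 : M ^+ 2 = D ^+ 2 + L ^+ 2 by rewrite sqr_sqrtr// addr_ge0 ?sqr_ge0.
have : 0 <= M by exact: sqrtr_ge0.
rewrite le_eqVlt => /predU1P[<-|M0].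
  by apply: sumr_ge0 => i _; exact: sqrtr_ge0.
rewrite -(ler_pM2l M0) -expr2 M2 mulr_sumr.
apply: (@le_trans _ _ (\sum_(i <- r) (D * a i + L * b i))).
  by rewrite big_split -!mulr_sumr !expr2 lerD// ler_wpM2l.
apply: ler_sum => i _; rewrite -sqrtrM ?addr_ge0 ?sqr_ge0//.
apply: (le_trans (ler_norm _)); rewrite -sqrtr_sqr ler_wsqrtr// -subr_ge0.
have -> : (D ^+ 2 + L ^+ 2) * (a i ^+ 2 + b i ^+ 2) - (D * a i + L * b i) ^+ 2 =
  (D * b i - L * a i) ^+ 2 by ring.
exact: sqr_ge0.
Qed.

(* The projection along [P 0 - P m] closes the polygon. *)
Lemma polygon_length_ge_projected k (P : nat -> 'rV[R]_k.+1) m T :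
  polygon_width_ge P m T -> 0 <= T -> P 0%N != P m ->
  Num.sqrt (enorm (P 0%N - P m) ^+ 2 +
            (2 * T * (Num.sqrt pi * mean_norm R k)) ^+ 2) <= polygon_length P m.
Proof.
move=> wid T0 P0m; set v := P 0%N - P m; set d := enorm v.
have d0 : 0 < d by rewrite enorm_gt0 subr_eq0.
pose e := d^-1 *: v.
have ve : dotp v e = d by rewrite dotpZr -sqr_enorm -/d expr2 mulKf// gt_eqF.
have e1 : dotp e e = 1 by rewrite {1}/e dotpZl ve mulVf// gt_eqF.
have [A [B [AB A_iso pythagoras]]] := orthogonal_projection e1.
have Bv : enorm (B v) = 0.
  by apply/eqP; have := pythagoras v; rewrite ve -/d => /eqP;
    rewrite -subr_eq0 opprD addrA subrr add0r oppr_eq0 sqrf_eq0.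
have -> : polygon_length P m = \sum_(i < m) Num.sqrt
    (`|dotp (P i - P i.+1) e| ^+ 2 + enorm (B (P i - P i.+1)) ^+ 2).
  apply: eq_bigr => i _; rewrite real_normK ?num_real// -pythagoras sqrtr_sqr.
  by rewrite ger0_norm ?enorm_ge0.
apply: sqrt_sum_sqr_le.
- exact: ltW.
- by rewrite !mulr_ge0 ?sqrtr_ge0 ?mean_norm_ge0.
- have := dist_le_variation (fun i => dotp (P i) e) (leq0n m).
  rewrite -dotpBl -/v ve gtr0_norm// big_mkord => /le_trans; apply.
  by apply: ler_sum => i _; rewrite -dotpBl.
- have := projected_polygon_length_ge AB A_iso wid.
  by rewrite -/v Bv subr0.
Qed.

Lemma polygon_length_ge n (P : nat -> 'rV[R]_n.+2) m T :
  polygon_width_ge P m T ->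
  2 * (pi - 1) / Num.sqrt pi * mean_norm R n.+2 * T <= polygon_length P m.
Proof.
move=> wid; have length0 : 0 <= polygon_length P m.
  by apply: sumr_ge0 => i _; exact: enorm_ge0.
move: (polygon_length_ge_endpoints wid) (polygon_length_ge_projected wid).
move: (mean_norm_ge0 R n.+2) (mean_norm_ratio R n) (pi_ge2 R) (sqrt_pi_gt0 R).
have : pi = Num.sqrt pi ^+ 2 :> R by rewrite sqr_sqrtr ?pi_ge0.
move: (mean_norm R n.+2) (mean_norm R n.+1) (@pi R) (Num.sqrt pi).
move=> r r' p s pE r0 ratio p_ge s0 length_open length_projected.
have coef0 : 0 <= 2 * (p - 1) / s * r
  by rewrite !mulr_ge0 ?invr_ge0 ?(ltW s0)//; lra.
have [T0|/ltW T0] := leP T 0.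
  by rewrite (le_trans _ length0)// mulr_ge0_le0.
have sr0 : 0 <= 2 * r / s * T by rewrite !mulr_ge0 ?invr_ge0 ?(ltW s0).
have [d_le|d_gt] := leP (enorm (P 0%N - P m)) (2 * r / s * T).
  apply: le_trans length_open.
  have -> : 2 * (p - 1) / s * r * T = 2 * T * (s * r) - 2 * r / s * T.
    by rewrite pE; field; rewrite gt_eqF.
  by rewrite lerB.
have P0m : P 0%N != P m.
  by rewrite -subr_eq0 -enorm_gt0; exact: le_lt_trans d_gt.
apply: le_trans (length_projected T0 P0m).
rewrite -[leLHS](ger0_norm (mulr_ge0 coef0 T0)) -sqrtr_sqr ler_wsqrtr//.
apply: (@le_trans _ _ ((2 * r / s * T) ^+ 2 + (2 * T * (s * r')) ^+ 2));
  last first.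
  by rewrite lerD2r ler_sqr ?nnegrE ?enorm_ge0// ltW.
have -> : (2 * (p - 1) / s * r * T) ^+ 2 =
    (2 * r / s * T) ^+ 2 + (2 * T * s) ^+ 2 * ((1 - 2 / p) * r ^+ 2).
  by rewrite pE; field; rewrite gt_eqF.
by rewrite lerD2l (mulrA (2 * T)) [leRHS]exprMn ler_wpM2l ?sqr_ge0.
Qed.

End Polygons.

(** * Polygons inscribed in a curve *)

Section Curves.
Variable R : realType.

Lemma compact_unif_continuous (U V : pseudoMetricType R) (A : set U)
    (f : U -> V) e :
  compact A -> {within A, continuous f} -> 0 < e ->
  exists2 d, 0 < d & forall x y, A x -> A y -> ball x d y -> ball (f x) e (f y).
Proof.
move=> /compact_near_coveringP/near_covering_withinP covA.
move=> /subspace_continuousP cf e0.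
pose Q (d : R) (x : U) := forall y, A y -> ball x d y -> ball (f x) e (f y).
have : \forall d \near 0^'+, A `<=` Q d.
  apply: covA => x Ax; have /cvg_ballP/(_ (e / 2)) := cf x Ax.
  rewrite divr_gt0// => /(_ isT).
  rewrite near_withinE => /nbhs_ballP[d /= d0 fd].
  exists (ball x (d / 2), [set r | r < d / 2]).
    split; first by apply: nbhsx_ballx; rewrite divr_gt0.
    by apply: nbhs_right_lt; rewrite divr_gt0.
  move=> [x' r] [/= xx' rd] Ax' y Ay x'y.
  have xx'd : ball x d x'
    by apply: le_ball xx'; rewrite ler_pdivrMr// ler_pMr// ler1n.
  have xyd : ball x d y.
    by apply: ball_split xx' _; apply: le_ball x'y; exact: ltW.
  by apply: ball_split (ball_sym (fd x' xx'd Ax')) (fd y xyd Ay).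
rewrite near_withinE => /nbhs_ballP[d /= d0 Qd].
exists (d / 2); first by rewrite divr_gt0.
move=> x y Ax Ay; apply: (Qd (d / 2)) => //; last by rewrite /= divr_gt0.
rewrite -ball_normE /= sub0r normrN gtr0_norm ?divr_gt0//.
by rewrite ltr_pdivrMr// ltr_pMr// ltr1n.
Qed.

Lemma exists_fine_partition (a b d : R) : a <= b -> 0 < d ->
  exists m t, Defs.partition a b m t /\ forall x, a <= x <= b ->
    exists2 i, (i <= m)%N & a <= t i <= b /\ `|x - t i| < d.
Proof.
rewrite le_eqVlt => /predU1P[<- d0|ab d0].
  exists 0%N, (fun=> a); split=> // x /le_anti <-.
  by exists 0%N => //; rewrite lexx subrr normr0.
have ba : 0 < b - a by rewrite subr_gt0.
pose m := (Num.truncn ((b - a) / d)).+1; pose s := (b - a) / m%:R.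
have m0 : 0 < m%:R :> R by rewrite ltr0n.
have s0 : 0 < s by rewrite divr_gt0.
have sd : s < d by rewrite ltr_pdivrMr// mulrC -ltr_pdivrMr//;
  exact: truncnS_gt.
have ms : m%:R * s = b - a by rewrite mulrC divfK// gt_eqF.
exists m, (fun i => a + i%:R * s); split.
  split; first by rewrite mul0r addr0.
  split; first by rewrite ms addrC subrK.
  by move=> i _; rewrite ltrD2l ltr_pM2r// ltr_nat.
move=> x /andP[ax xb]; pose i := Num.truncn ((x - a) / s).
have : i%:R <= (x - a) / s < i.+1%:R.
  by apply: truncn_itv; rewrite divr_ge0 ?subr_ge0// ltW.
rewrite ler_pdivlMr// ltr_pdivrMr// -natr1 mulrDl mul1r => /andP[i_le i_gt].
exists i; first by rewrite -(ler_nat R) -(ler_pM2r s0) ms; lra.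
have is0 : 0 <= i%:R * s by rewrite mulr_ge0// ltW.
by split; [apply/andP; split; lra|rewrite ger0_norm; lra].
Qed.

Definition polygon_net n (S : set 'rV[R]_n) (P : nat -> 'rV[R]_n) m
    (e : R) : Prop :=
  forall x, S x -> exists2 i, (i <= m)%N & enorm (x - P i) <= e.

Lemma inscribed_polygon_net n (phi : R -> 'rV[R]_n) (a b e : R) : a <= b ->
  {within `[a, b], continuous phi} -> 0 < e ->
  exists m P, polygon_net (phi @` `[a, b]) P m e /\
    ((polygon_length P m)%:E <= curve_length phi a b)%E.
Proof.
move=> ab cphi e0; have n1 : 0 < n%:R + 1 :> R by rewrite ltr_wpDl.
have [d d0 phi_d] :=
  compact_unif_continuous (@segment_compact R a b) cphi (divr_gt0 e0 n1).
have [m [t [t_part t_fine]]] := exists_fine_partition ab d0.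
exists m, (fun i => phi (t i)); split; last first.
  by apply: ereal_sup_ubound; exists m, t.
move=> _ [x /= /[!in_itv]/= xab <-]; have [i im [tab xt]] := t_fine x xab.
exists i => //; apply: (le_trans (enorm_le_norm _)).
have := phi_d x (t i);
  rewrite /= !in_itv/= -!ball_normE/= => /(_ xab tab xt) phi_xt.
apply: (@le_trans _ _ (n%:R * (e / (n%:R + 1))));
  first by rewrite ler_wpM2l// ltW.
by rewrite mulrCA -[leRHS]mulr1 ler_wpM2l ?(ltW e0)// ler_pdivrMr// mul1r lerDl.
Qed.

Lemma support_fun_net n (K S : set 'rV[R]_n) P m e u :
  K !=set0 -> K `<=` co S -> polygon_net S P m e ->
  exists2 p, (p <= m)%N & support_fun K u <= dotp (P p) u + e * enorm u.
Proof.
move=> [x0 Kx0] KS net.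
have [p _ P_max] :=
  @arg_maxP _ _ _ (@ord0 m) xpredT (fun i => dotp (P i) u) isT.
exists p; first by rewrite -ltnS.
apply: ge_sup; first by exists (dotp x0 u), x0.
move=> _ [x /KS [k [z [l [Sz [l0 [l1 ->]]]]]] <-].
rewrite dotp_suml -[leRHS]mul1r -l1 mulr_suml; apply: ler_sum => i _.
rewrite dotpZl ler_wpM2l//; have [j jm Pj] := net _ (Sz i).
have : dotp (z i - P j) u <= e * enorm u.
  by apply: le_trans (dotp_le_enorm _ _) _; rewrite ler_wpM2r ?enorm_ge0.
by rewrite dotpBl; have /= := P_max (Ordinal (jm : j < m.+1)%N) isT; lra.
Qed.

Lemma polygon_width_ge_net n (K S : set 'rV[R]_n) Theta P m e :
  K !=set0 -> constant_width K Theta -> K `<=` co S -> polygon_net S P m e ->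
  polygon_width_ge P m (Theta - 2 * e).
Proof.
move=> K0 K_width KS net u; have [->|u0] := eqVneq u 0.
  by exists 0%N, 0%N; rewrite subrr dot0p /enorm dot0p sqrtr0 mulr0.
have u_gt0 : 0 < enorm u by rewrite enorm_gt0.
pose v := (enorm u)^-1 *: u.
have v1 : enorm v = 1
  by rewrite enormZ ger0_norm ?invr_ge0 ?ltW// mulVf// gt_eqF.
have [p pm p_le] := support_fun_net v K0 KS net.
have [q qm q_le] := support_fun_net (- v) K0 KS net.
exists p, q; split=> //; rewrite -ler_pdivlMr// [leRHS]mulrC -dotpZr -/v dotpBl.
have <- : width_fun K v = Theta by apply: K_width; rewrite -sqr_enorm v1 expr1n.
move: p_le q_le; rewrite /width_fun dotpNr enormN v1; lra.
Qed.

End Curves.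

Theorem theorem3 (R : realType) (n : nat) (K : set 'rV[R]_n) (Theta : R)
    (a b : R) (phi : R -> 'rV[R]_n) :
  (2 <= n)%N ->
  convex_body K -> constant_width K Theta ->
  a <= b -> {within `[a, b], continuous phi} ->
  K `<=` co (phi @` `[a, b]) ->
  ((2 * (pi - 1) * Gamma ((n%:R + 1) / 2)
     / (Num.sqrt pi * Gamma (n%:R / 2)) * Theta)%:E
   <= curve_length phi a b)%E.
Proof.
case: n K phi => [//|[//|n]] K phi n2 [K0 _] K_width ab cphi Kphi.
pose c := 2 * (pi - 1) / Num.sqrt pi * mean_norm R n.+2.
have -> : 2 * (pi - 1) * Gamma ((n.+2%:R + 1) / 2) /
    (Num.sqrt pi * Gamma (n.+2%:R / 2)) = c.
  by rewrite /c mean_norm_Gamma// invfM; ring.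
have c0 : 0 <= c.
  apply: mulr_ge0 (mean_norm_ge0 _ _); rewrite divr_ge0 ?sqrtr_ge0// mulr_ge0//.
  by have := pi_ge2 R; lra.
apply/lee_addgt0Pr => e e0; pose e' := e / (2 * c + 1).
have c1 : 0 < 2 * c + 1 by lra.
have e'0 : 0 < e' by exact: divr_gt0.
have [m [P [net length_le]]] := inscribed_polygon_net ab cphi e'0.
have length_ge := polygon_length_ge (polygon_width_ge_net K0 K_width Kphi net).
have e'_le : 2 * c * e' <= e.
  rewrite mulrCA -[leRHS]mulr1 ler_wpM2l ?(ltW e0)//.
  by rewrite ler_pdivrMr// mul1r lerDl.
apply: le_trans (leeD2r e%:E length_le).
by rewrite -EFinD lee_fin; move: length_ge; rewrite -/c; lra.
Qed.
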